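(* Let $\Omega$ be any real distribution with finite sixth moment, let $A$ be an $n\times n$ random matrix with i.i.d. entries of distribution $\Omega$, and let $f_6(n)=\mathbb{E}(\det A)^6$ (with $f_6(0)=1$). Then the generating function $F_6(t)=\sum_{n=0}^\infty f_6(n)\,t^n/(n!)^2$ is D-finite.
   Context: A formal power series $F(t)$ is D-finite if it satisfies a linear differential equation $\sum_{i=0}^{d}a_i(t)F^{(i)}(t)=0$ with polynomial coefficients $a_i$, not all zero. *)

(* Defs.v *)
(* MathComp-Analysis, over an arbitrary [R : realType]. *)
From mathcomp Require Import all_boot all_order all_algebra.
From mathcomp Require Import all_classical all_reals all_analysis.

Set Implicit Arguments.
Unset Strict Implicit.
Unset Printing Implicit Defensive.

Import Order.TTheory GRing.Theory Num.Theory.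
Import numFieldNormedType.Exports.

Local Open Scope classical_set_scope.
Local Open Scope ring_scope.

(* A formal power series F(t) = \sum_n F_n t^n is represented by its
   coefficient sequence [F : nat -> R]. *)

Definition fps_deriv (R : nzRingType) (F : nat -> R) : nat -> R :=
  fun n => n.+1%:R * F n.+1.

(* Cauchy product of a polynomial with a formal power series. *)
Definition poly_fps_mul (R : nzRingType) (p : {poly R}) (F : nat -> R) :
    nat -> R :=
  fun n => \sum_(k < n.+1) p`_k * F (n - k)%N.

Definition D_finite (R : nzRingType) (F : nat -> R) : Prop :=
  exists (d : nat) (a : 'I_d.+1 -> {poly R}),
    (exists i, a i != 0) /\
    forall n : nat,
      \sum_(i < d.+1) poly_fps_mul (a i) (iter i (@fps_deriv R) F) n = 0.

Definition mutually_independent (R : realType) (d : measure_display)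
    (T : measurableType d) (P : probability T R) (I : finType)
    (X : I -> {RV P >-> R}) : Prop :=
  forall (J : {set I}) (B : I -> set R),
    (forall i, measurable (B i)) ->
    P (\bigcap_(i in [set` J]) X i @^-1` B i) =
      (\prod_(i in J) P (X i @^-1` B i))%E.

Definition iid_entries (R : realType) (Omega : probability R R)
    (d : measure_display) (T : measurableType d) (P : probability T R)
    (n : nat) (A : 'I_n -> 'I_n -> {RV P >-> R}) : Prop :=
  mutually_independent (fun ij : 'I_n * 'I_n => A ij.1 ij.2) /\
  forall (i j : 'I_n) (B : set R),
    measurable B -> distribution P (A i j) B = Omega B.

(* E[(det A)^k].  The expectation is extended-real valued; it is finite as soon
   as the entries are independent with finite k-th absolute moment, since
   (det A)^k has degree at most k in each entry, so [fine] loses nothing there.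
   For n = 0 the determinant is 1, whence the value 1. *)
Definition det_moment (R : realType) (d : measure_display)
    (T : measurableType d) (P : probability T R) (k n : nat)
    (A : 'I_n -> 'I_n -> {RV P >-> R}) : R :=
  fine ('E_P[fun w => \det (\matrix_(i < n, j < n) A i j w) ^+ k]).

(* Main.v *)
From HB Require Import structures.
Require Import Defs.
From mathcomp Require Import all_boot all_order all_fingroup all_algebra.
From mathcomp Require Import zify ring lra.
From mathcomp Require Import ssrcomplements.
From mathcomp Require Import -(notations) mpoly.
Set Implicit Arguments.
Unset Strict Implicit.
Unset Printing Implicit Defensive.
Import Order.TTheory GRing.Theory Num.Theory.
Local Open Scope ring_scope.

(** The argument gives no closed formula; it works for every power [K] of the
determinant and rests on two ideas.

The first is a formula for the moments.  The power [det A ^ K] is the top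
coefficient of a product in the Grassmann algebra that has a generator
[theta_(k, a)] for each column, or site, [k < n] and each colour [a < K]; the
colours tell the [K] copies of the matrix apart.  Every row of [A] contributes
one factor.  Its average over the entries of the row is, for every law of the
entries, a fixed polynomial in the power sums [Z_S], the sum over the sites [k]
of the product of the [theta_(k, a)] with [a] in [S], where [S] is a set of
colours ([row_op_words]).  This is Moebius inversion over set partitions: the
coefficients generalise cumulants.  The power sums with an even number of
colours are central, and those with an odd number square to zero.  A product of
power sums is thus given by a monomial in commuting variables and one of
finitely many odd words.  Its top coefficient is read off site by site
([word_valS]), and is again a coefficient in a power-like sequence of
polynomials ([pairing_col_poly]).  So the [K]-th moment is a finite sum, over
odd words, of the pairings of a polynomial [P_n(y)] from the rows with a
polynomial [Q_n(z)] from the columns, where [y ^ a] and [z ^ b] pair to [a!] if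
[a = b] and to [0] otherwise.  Both sequences solve triangular linear
recurrences, so their exponential generating functions are polynomial multiples
of exponentials [exp(t p)].  As [P_i] and [Q_j] come from [i] rows and [j]
columns, they pair to zero unless [i = j].  Therefore [E (det A) ^ K / n! ^ 2] is
the coefficient of [t ^ (2 n)] in the pairing of one function
[q(t, y, z) exp(t p(y, z))] ([moments_exp_coef]).

The second idea is Bernstein's counting argument for holonomic functions.  Let
[N] be the number of the variables [y] and [z].  The pairing kills the image of
the operators [D_i], multiplication by the dual of the variable [x_i] minus
differentiation in [x_i].  There are [v ^ (N + 2)] operators
[s ^ (a + b) (d/ds) ^ b D ^ alpha], with [s = t ^ 2] and exponents [a], [b] and
[alpha_i] below [v].  They map [q exp(t p)] to multiples of [exp(t p)] by
polynomials of degree [O(v)] in [N + 1] variables, a space of dimension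
[O(v ^ (N + 1))].  Hence a nontrivial combination of them annihilates
[q exp(t p)] ([weyl_annihilator]).  Multiplying it by a suitable monomial in the
[x_i] before pairing isolates a nonzero operator in [s] and [d/ds] that
annihilates the generating function ([pairing_annihilator]). *)

(** * Signs of words *)

Fixpoint inv_count (w : seq nat) : nat :=
  if w is x :: w' then (count (fun y => y < x)%N w' + inv_count w')%N else 0%N.

(** Inversions between a letter of [u] and a later letter of [v]. *)
Definition cross_inv (u v : seq nat) : nat :=
  sumn [seq count (fun y => y < x)%N v | x <- u].

Lemma inv_count_cat u v :
  inv_count (u ++ v) = (inv_count u + inv_count v + cross_inv u v)%N.
Proof.
elim: u => [|x u IH] /=; first by rewrite /cross_inv /= addn0.
by rewrite count_cat IH /cross_inv /=; lia.
Qed.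

Lemma cross_inv_catr u v1 v2 :
  cross_inv u (v1 ++ v2) = (cross_inv u v1 + cross_inv u v2)%N.
Proof.
elim: u => [|x u IH] //=; move: IH; rewrite /cross_inv /= count_cat => ->.
lia.
Qed.

Lemma cross_inv_cons u y v :
  cross_inv u (y :: v) = (count (fun x => y < x)%N u + cross_inv u v)%N.
Proof.
elim: u => [|x u IH] //=; move: IH; rewrite /cross_inv /= => ->.
lia.
Qed.

Lemma cross_inv_swap u v : ~~ has (mem v) u ->
  (cross_inv u v + cross_inv v u = size u * size v)%N.
Proof.
elim: u => [|x u IH] /=; first by move=> _; elim: v => [|y v].
rewrite negb_or => /andP[xv /IH uv].
rewrite cross_inv_cons {1}/cross_inv /= -/(cross_inv u v).
have -> : (count (fun y => y < x)%N v + cross_inv u v +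
   (count (fun y => x < y)%N v + cross_inv v u) =
   count (fun y => y < x)%N v + count (fun y => x < y)%N v + size u * size v)%N.
  by rewrite -uv; lia.
suff -> : (count (fun y => y < x)%N v + count (fun y => x < y)%N v = size v)%N.
  by rewrite mulSn.
elim: v xv {IH uv} => [|y v IH] //=; rewrite inE negb_or => /andP[xy /IH H].
by rewrite -[in RHS]H; case: (ltngtP x y) xy => //= _ _; lia.
Qed.

Lemma cross_inv_lt u v M : all (fun x => x < M)%N u ->
  all (fun x => M <= x)%N v -> cross_inv u v = 0%N.
Proof.
move=> hu hv; rewrite /cross_inv; elim: u hu => [|x u IH] //= /andP[xM /IH ->].
rewrite addn0; apply/eqP; rewrite eqn0Ngt -has_count; apply/hasPn => y yv.
by rewrite -leqNgt; apply: leq_trans (ltnW xM) (allP hv _ yv).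
Qed.

Section Alternating.
Variable R : realFieldType.
Implicit Type phi : seq nat -> R.

(** The sign of a word that uses every letter [0, ..., M - 1] once, and zero on
all other words: the coefficient of the product of the letters, read in the
Grassmann algebra on [M] generators, at the top monomial.  Working with this
functional replaces the Grassmann algebra itself. *)
Definition word_sign (M : nat) (w : seq nat) : R :=
  if perm_eq w (iota 0 M) then (-1) ^+ inv_count w else 0.

(** Functionals that see a word only through its class in the Grassmann
algebra: exchanging two neighbouring blocks costs the Koszul sign. *)
Definition alternating phi : Prop :=
  forall u a b v, phi (u ++ a ++ b ++ v) =
    (-1) ^+ (size a * size b) * phi (u ++ b ++ a ++ v).

(** Only the inversions between [a] and [b] change, and together with their
reversals they number [size a * size b]. *)
Lemma word_sign_alt M : alternating (word_sign M).
Proof.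
move=> u a b v; rewrite /word_sign.
have pe : perm_eq (u ++ a ++ b ++ v) (u ++ b ++ a ++ v).
  by rewrite perm_cat2l perm_catCA.
rewrite (permPl pe); case: ifP => [pw|_]; last by rewrite mulr0.
have: uniq (u ++ b ++ a ++ v) by rewrite (perm_uniq pw) iota_uniq.
rewrite !cat_uniq => /and3P[_ _ /and3P[_ + _]].
rewrite has_cat negb_or => /andP[/cross_inv_swap ab _].
rewrite -exprD -[LHS]signr_odd -[RHS]signr_odd; congr (_ ^+ (nat_of_bool _)).
rewrite -ab !inv_count_cat !cross_inv_catr; lia.
Qed.

Lemma word_sign_iota M : word_sign M (iota 0 M) = 1.
Proof.
rewrite /word_sign perm_refl.
suff -> : inv_count (iota 0 M) = 0%N by [].
elim: M {1}0%N => [|M IH] m //=; rewrite IH addn0.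
apply/eqP; rewrite eqn0Ngt -has_count; apply/hasPn => y.
by rewrite mem_iota -leqNgt => /andP[/ltnW].
Qed.

Lemma word_sign_cat M N u v :
  all (fun x => x < M)%N u -> all (fun x => M <= x)%N v ->
  word_sign (M + N) (u ++ v) =
    word_sign M u * word_sign N [seq (x - M)%N | x <- v].
Proof.
move=> hu hv; rewrite /word_sign.
have -> : perm_eq (u ++ v) (iota 0 (M + N)) =
   perm_eq u (iota 0 M) && perm_eq [seq (x - M)%N | x <- v] (iota 0 N).
  have fu : [seq x <- u ++ v | (x < M)%N] = u.
    rewrite filter_cat (all_filterP hu) -[RHS]cats0; congr (_ ++ _).
    apply/eqP; rewrite -[_ == _]negbK -has_filter; apply/hasPn => x xv.
    by rewrite -leqNgt (allP hv).
  have fv : [seq x <- u ++ v | ~~ (x < M)%N] = v.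
    rewrite filter_cat.
    have -> : [seq x <- u | ~~ (x < M)%N] = [::].
      apply/eqP; rewrite -[_ == _]negbK -has_filter; apply/hasPn => x xv.
      by rewrite negbK (allP hu).
    by apply/all_filterP/allP => x xv; rewrite -leqNgt (allP hv).
  have eN : iota M N = map (addn M) (iota 0 N) by rewrite -iotaDl addn0.
  have vK : map (addn M) [seq (x - M)%N | x <- v] = v.
    rewrite -map_comp -[RHS]map_id; apply/eq_in_map => x xv /=.
    by rewrite subnKC // (allP hv).
  rewrite iotaD add0n eN; apply/idP/andP => [pe|[pu pv]].
    split.
      have /(perm_filter (fun x => x < M)%N) := pe.
      rewrite fu filter_cat.
      have -> : [seq x <- iota 0 M | (x < M)%N] = iota 0 M.
        by apply/all_filterP/allP => x; rewrite mem_iota add0n.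
      have -> : [seq x <- map (addn M) (iota 0 N) | (x < M)%N] = [::].
        apply/eqP; rewrite -[_ == _]negbK -has_filter; apply/hasPn => x.
        by case/mapP => y _ ->; rewrite -leqNgt leq_addr.
      by rewrite cats0.
    have /(perm_filter (fun x => ~~ (x < M))%N) := pe.
    rewrite fv filter_cat.
    have -> : [seq x <- iota 0 M | ~~ (x < M)%N] = [::].
      apply/eqP; rewrite -[_ == _]negbK -has_filter; apply/hasPn => x.
      by rewrite negbK mem_iota add0n.
    have -> : [seq x <- map (addn M) (iota 0 N) | ~~ (x < M)%N]
        = map (addn M) (iota 0 N).
      apply/all_filterP/allP => x /mapP[y _ ->].
      by rewrite -leqNgt leq_addr.
    move=> /(perm_map (fun x => x - M)%N); rewrite -map_comp.
    have -> // : [seq ((fun x => x - M)%N \o addn M) i | i <- iota 0 N] = iota 0 N.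
    by rewrite -[RHS]map_id; apply: eq_map => x /=; rewrite addKn.
  by rewrite -{1}vK; apply: perm_cat => //; apply: perm_map.
have -> : inv_count (u ++ v) =
    (inv_count u + inv_count [seq (x - M)%N | x <- v])%N.
  rewrite inv_count_cat (cross_inv_lt hu hv) addn0; congr (_ + _)%N.
  elim: v hv => [|y v IH] //= /andP[yM hv]; rewrite IH //; congr (_ + _)%N.
  rewrite count_map; apply: eq_in_count => z zv /=.
  by have := allP hv z zv => /= ?; lia.
rewrite exprD; case: (perm_eq u _) => //=; last by rewrite mul0r.
by case: (perm_eq _ _); rewrite ?mulr0.
Qed.

Lemma alternating_swap phi u x v y t : alternating phi ->
  phi (u ++ x :: v ++ y :: t) = - phi (u ++ y :: v ++ x :: t).
Proof.
move=> alt; have := alt u [:: x] (rcons v y) t; rewrite /= !cat_rcons => ->.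
have := alt u v [:: y] (x :: t); rewrite /= => ->.
rewrite mulrA -exprD size_rcons.
rewrite mul1n muln1 addSn exprS addnn -muln2 mulnC exprM sqrrN expr1n expr1n.
by rewrite mulr1 mulN1r.
Qed.

Lemma alternating_tperm phi (T : finType) (f : T -> nat) (ps : seq T) p q :
  alternating phi -> uniq ps -> p \in ps -> q \in ps -> p != q ->
  phi [seq f (tperm p q x) | x <- ps] = - phi (map f ps).
Proof.
move=> alt; wlog: p q / (index p ps <= index q ps)%N => [hw|].
  case/orP: (leq_total (index p ps) (index q ps)); first exact: hw.
  by move=> le U ? ? ?; rewrite tpermC; apply: hw => //; rewrite eq_sym.
move=> + U pps.
case/splitPr: pps U => u t; rewrite cat_uniq /= negb_or => /and4P[uu /andP[pu hu] pt ut].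
move=> idx; rewrite mem_cat inE => /or3P[qu|/eqP->|qt] pq; last 1 first.
- case/splitPr: qt ut pt hu {idx} => v w; rewrite cat_uniq mem_cat inE /=.
  rewrite !negb_or has_cat /= !negb_or.
  move=> /and4P[uv /andP[qv hw] qw uw] /and3P[pv pq' pw] /and3P[hvu qu wu].
  rewrite map_cat /= map_cat /= tpermL tpermR alternating_swap //.
  rewrite [in RHS]map_cat /= map_cat /=.
  have E s : p \notin s -> q \notin s -> [seq f (tperm p q x) | x <- s] = map f s.
    move=> np nq; apply/eq_in_map => x xs; rewrite tpermD //.
      by apply: contraNneq np => ->.
    by apply: contraNneq nq => ->.
  by rewrite !E.
- by move: idx; rewrite !index_cat qu (negbTE pu) /= eqxx addn0 leqNgt index_mem qu.
- by rewrite eqxx in pq.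
Qed.

(** Rearranging a stretch of letters costs a sign that depends on the
rearrangement only. *)
Lemma alternating_perm (T : eqType) (p q : seq T) : perm_eq p q ->
  exists sg : R, forall phi (g : T -> nat) u v, alternating phi ->
    phi (u ++ map g p ++ v) = sg * phi (u ++ map g q ++ v).
Proof.
rewrite perm_sym; move: p; pose P p := exists sg : R,
  forall phi (g : T -> nat) u v, alternating phi ->
    phi (u ++ map g p ++ v) = sg * phi (u ++ map g q ++ v).
move=> p qp; apply: (@catCA_perm_ind _ P _ q p qp); last first.
  by exists 1 => *; rewrite mul1r.
move=> s1 s2 s3 [sg H]; exists ((-1) ^+ (size s2 * size s1) * sg) => phi g u v alt.
have := H phi g u v alt.
rewrite !map_cat -!catA => e.
by rewrite alt e mulrA !size_map.
Qed.

Definition ffun_sign n (c : {ffun 'I_n -> 'I_n}) : R :=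
  if insub c is Some s then (-1) ^+ (s : {perm 'I_n}) else 0.

(** A permutation is a product of transpositions, and a function with a repeated
value is fixed by one. *)
Lemma ffun_signE n (h : {ffun 'I_n -> 'I_n} -> R) :
  (forall (c : {ffun _}) i j, i != j -> h [ffun x => c (tperm i j x)] = - h c) ->
  forall c, h c = ffun_sign c * h [ffun x => x].
Proof.
move=> alt c; rewrite /ffun_sign; case: insubP => [s _ <-|].
  have [ts -> dts] := prod_tpermP s.
  elim: ts dts => [|[i j] ts IH] /= => [_|/andP[ij /IH]].
    rewrite big_nil odd_perm1 mul1r; congr h; apply/ffunP => x.
    by rewrite ffunE pvalE perm1.
  rewrite big_cons odd_permM odd_tperm ij signr_addb mulN1r mulNr => <-.
  by rewrite -(alt _ i j ij); congr h; apply/ffunP => x; rewrite ffunE !pvalE permM.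
move=> ni; rewrite mul0r.
have [i [j [ij cij]]] : exists i j, i != j /\ c i = c j.
  move/injectivePn: ni => [i [j ij e]].
  by exists i, j.
have := alt c i j ij.
have -> : [ffun x => c (tperm i j x)] = c.
  by apply/ffunP => x; rewrite ffunE; case: tpermP => // ->.
by move=> e; lra.
Qed.

Lemma det_ffun_sign n (A : 'M[R]_n) :
  \det A = \sum_(c : {ffun 'I_n -> 'I_n}) (\prod_i A i (c i)) * ffun_sign c.
Proof.
rewrite /determinant.
rewrite [RHS](bigID (fun c : {ffun 'I_n -> 'I_n} => injectiveb c)) /=.
rewrite [X in _ + X]big1 ?addr0 => [|c nc]; last first.
  by rewrite /ffun_sign; case: insubP => [s|]; rewrite ?(negbTE nc) ?mulr0.
rewrite (reindex (fun s : 'S_n => val s)) /=; last first.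
  exists (insubd (1 : 'S_n)%g) => [s _|c cinj]; first by rewrite valKd.
  by rewrite insubdK.
apply: eq_big => [s|s _]; first by rewrite (valP s).
rewrite /ffun_sign valK mulrC; congr (_ * _).
by apply: eq_bigr => i _; rewrite pvalE.
Qed.

(** The letters that a row contributes when its copy of colour [a] uses the
column [c a]; the generator of site [k] and colour [a] is the letter [k * K + a]. *)
Definition row_word K n (c : {ffun 'I_K -> 'I_n}) : seq nat :=
  [seq (c a * K + a)%N | a : 'I_K <- enum 'I_K].

Definition rows_word K m n (C : {ffun 'I_m -> {ffun 'I_K -> 'I_n}}) : seq nat :=
  flatten [seq row_word (C i) | i <- enum 'I_m].

Lemma rows_wordE K m n (C : {ffun 'I_m -> {ffun 'I_K -> 'I_n}}) :
  rows_word C = [seq (C p.1 p.2 * K + p.2)%N |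
    p : 'I_m * 'I_K <- [seq (i, a) | i <- enum 'I_m, a <- enum 'I_K]].
Proof.
rewrite /rows_word; elim: (enum 'I_m) => [|i s IH] //=.
by rewrite map_cat IH -map_comp.
Qed.

Lemma rows_word_id K n :
  rows_word [ffun i : 'I_n => [ffun a : 'I_K => i]] = iota 0 (n * K).
Proof.
rewrite /rows_word.
have -> : [seq row_word ([ffun i : 'I_n => [ffun _ : 'I_K => i]] i) | i <- enum 'I_n]
    = [seq [seq (i * K + a)%N | a <- iota 0 K] | i <- [seq val j | j <- enum 'I_n]].
  rewrite -map_comp; apply: eq_map => i.
  rewrite /row_word -[iota 0 K]val_enum_ord /= -map_comp; apply: eq_map => a.
  by rewrite /= !ffunE.
rewrite val_enum_ord; elim: n => [|n IH]; first by rewrite mul0n.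
rewrite -addn1 iotaD map_cat flatten_cat IH /= cats0 add0n addn1 mulSn addnC iotaD.
by rewrite add0n -[in iota (n * K) K](addn0 (n * K)%N) iotaDl.
Qed.

(** The [K]-th power of the determinant as one signed sum: the [K] copies of a
row are read together, and [K] colours tell the copies apart. *)
Lemma det_pow K n (A : 'M[R]_n) :
  \det A ^+ K = \sum_(C : {ffun 'I_n -> {ffun 'I_K -> 'I_n}})
    (\prod_i \prod_a A i (C i a)) * word_sign (n * K) (rows_word C).
Proof.
pose tr m p (D : {ffun 'I_m -> {ffun 'I_p -> 'I_n}}) :=
  [ffun i => [ffun a => D a i]] : {ffun 'I_p -> {ffun 'I_m -> 'I_n}}.
have trK m p : cancel (@tr m p) (@tr p m).
  by move=> D; apply/ffunP => i; apply/ffunP => a; rewrite !ffunE.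
rewrite (reindex (@tr K n)) /=; last by exists (@tr n K) => ? _; apply: trK.
pose g (D : {ffun 'I_K -> {ffun 'I_n -> 'I_n}}) : R := word_sign (n * K) (rows_word (tr _ _ D)).
have gsgn (s : seq 'I_K) D : uniq s -> g D = (\prod_(a <- s) ffun_sign (D a)) *
    g [ffun a => if a \in s then [ffun x => x] else D a].
  elim: s => [_|a s IH /= /andP[as_ us]].
    by rewrite big_nil mul1r; congr g; apply/ffunP => a; rewrite ffunE.
  rewrite big_cons IH // -mulrA mulrCA; congr (_ * _).
  pose h c := g [ffun b => if b \in s then [ffun x => x] else
                           if b == a then c else D b].
  have -> : g [ffun b => if b \in s then [ffun x => x] else D b] = h (D a).
    congr g; apply/ffunP => b; rewrite !ffunE; case: ifP => // _.
    by case: eqP => // ->.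
  rewrite (@ffun_signE _ h); last first.
    move=> c i j ij; rewrite /h /g !rows_wordE.
    rewrite -(@alternating_tperm _ _ _ _ (i, a) (j, a)) //; first last.
    - by rewrite xpair_eqE negb_and ij.
    - by apply: allpairs_f; rewrite mem_enum.
    - by apply: allpairs_f; rewrite mem_enum.
    - by apply: allpairs_uniq; rewrite ?enum_uniq // => -[? ?] [? ?].
    - exact: word_sign_alt.
    congr (word_sign _ _); apply: eq_map => -[i' b] /=; rewrite !ffunE.
    have [->|ba] := eqVneq b a.
      have -> : tperm (i, a) (j, a) (i', a) = (tperm i j i', a).
        case: (tpermP i j i') => [->|->|/eqP ni /eqP nj].
        - by rewrite tpermL.
        - by rewrite tpermR.
        - by rewrite tpermD // xpair_eqE eqxx andbT eq_sym.
      by rewrite /= (negbTE as_) eqxx ffunE.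
    rewrite tpermD ?xpair_eqE ?[a == _]eq_sym ?(negbTE ba) ?andbF //=.
  congr (_ * _); congr g; apply/ffunP => b; rewrite !ffunE inE.
  by case: (b \in s); rewrite ?orbT ?orbF //.
transitivity (\sum_(D : {ffun 'I_K -> {ffun 'I_n -> 'I_n}})
   \prod_a ((\prod_i A i (D a i)) * ffun_sign (D a))); last first.
  apply: eq_bigr => D _; rewrite big_split /=.
  rewrite exchange_big /=.
  congr (_ * _); first by apply: eq_bigr => i _; apply: eq_bigr => a _; rewrite !ffunE.
  rewrite -/(g D) (gsgn (enum 'I_K)) ?enum_uniq // big_enum /=.
  rewrite -[LHS]mulr1; congr (_ * _).
  have -> : [ffun a => if a \in enum 'I_K then [ffun x => x] else D a] =
     tr _ _ [ffun i : 'I_n => [ffun a : 'I_K => i]].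
    by apply/ffunP => a; rewrite !ffunE mem_enum; apply/ffunP => i; rewrite !ffunE.
  by rewrite /g trK rows_word_id word_sign_iota.
rewrite -(bigA_distr_bigA (fun (a : 'I_K) (c : {ffun 'I_n -> 'I_n}) =>
  (\prod_i A i (c i)) * ffun_sign c)).
by rewrite -det_ffun_sign prodr_const card_ord.
Qed.

End Alternating.

(** * Expanding a row of moments into power sums *)

Section ZetaInversion.
Variables (R : pzRingType) (T : finType) (le : rel T) (valid : pred T).
Variable rank : T -> nat.
Hypothesis le_refl : forall x, valid x -> le x x.
Hypothesis le_rank : forall x y, valid y -> le x y -> x != y ->
  (rank x < rank y)%N.

(** Moebius inversion: the zeta matrix of a ranked relation is unitriangular. *)
Lemma zeta_surjective (g : T -> R) :
  exists h, forall x, valid x -> g x = \sum_(y | le y x) h y.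
Proof.
suff H n : exists h, forall x, (rank x < n)%N -> valid x ->
    g x = \sum_(y | le y x) h y.
  have [h hP] := H (\max_x rank x).+1; exists h => x vx.
  by apply: hP => //; rewrite ltnS leq_bigmax.
elim: n => [|n [h hP]]; first by exists (fun=> 0).
exists (fun x => if (rank x < n)%N then h x else
                 g x - \sum_(y | le y x && (y != x)) h y) => x rx vx.
rewrite (bigD1 x) ?le_refl //=; case: ifP => [rxn|nrx].
  rewrite hP // (bigD1 x) ?le_refl //=; congr (_ + _).
  apply: eq_bigr => y /andP[yx ynx].
  by rewrite (ltn_trans (le_rank vx yx ynx) rxn).
apply/esym/eqP; rewrite -addrA -[X in _ == X]addr0; apply/eqP; congr (_ + _).
apply/eqP; rewrite addrC subr_eq0; apply/eqP.
apply: eq_bigr => y /andP[yx ynx].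
by rewrite (leq_trans (le_rank vx yx ynx)).
Qed.
End ZetaInversion.

Lemma big_tupleS (R : Type) (idx : R) (op : Monoid.com_law idx) n (T : finType)
    (F : n.+1.-tuple T -> R) :
  \big[op/idx]_t F t =
    \big[op/idx]_(k : T) \big[op/idx]_(t : n.-tuple T) F [tuple of k :: t].
Proof.
rewrite pair_big /=.
rewrite (reindex (fun p : T * n.-tuple T => [tuple of p.1 :: p.2])) //=.
exists (fun t : n.+1.-tuple T => (thead t, [tuple of behead t])) => [[k t] _|t _] /=.
  by rewrite theadE; congr pair; apply: val_inj.
by rewrite -tuple_eta.
Qed.

Section Rows.
Variables (R : realFieldType) (K : nat).
Implicit Types (phi : seq nat -> R) (S : {set 'I_K}) (s : seq {set 'I_K}).

Definition block S (k : nat) : seq nat := [seq (k * K + a)%N | a : 'I_K <- enum S].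

Lemma size_block S k : size (block S k) = #|S|.
Proof. by rewrite size_map cardE. Qed.

(** Multiplication by the power sum of the letter [S] over the sites
[0, ..., n - 1], as an operation on functionals. *)
Definition letter_op (n : nat) S phi : seq nat -> R :=
  fun u => \sum_(k < n) phi (u ++ block S k).

Definition word_op n phi s : seq nat -> R := foldr (letter_op n) phi s.

Lemma letter_op_alt n S phi : alternating phi -> alternating (letter_op n S phi).
Proof.
move=> alt u a b v; rewrite /letter_op mulr_sumr; apply: eq_bigr => k _.
by rewrite -!catA alt.
Qed.

Lemma word_op_alt n s phi : alternating phi -> alternating (word_op n phi s).
Proof. by move=> alt; elim: s => [|S s IH] //=; apply: letter_op_alt. Qed.

Lemma word_op_cat n phi s1 s2 :
  word_op n phi (s1 ++ s2) = word_op n (word_op n phi s2) s1.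
Proof. exact: foldr_cat. Qed.

Lemma word_op_ext n phi phi' s : phi =1 phi' -> word_op n phi s =1 word_op n phi' s.
Proof.
move=> e; elim: s => [|S s IH] //= u.
by apply: eq_bigr => k _; rewrite IH.
Qed.

Lemma word_op_tuple n phi (T : Type) (f : T -> {set 'I_K}) (xs : seq T) u :
  word_op n phi (map f xs) u = \sum_(t : (size xs).-tuple 'I_n)
    phi (u ++ flatten [seq block (f x.1) x.2 | x : T * 'I_n <- zip xs t]).
Proof.
elim: xs u => [|x xs IH] u /=.
  rewrite (bigD1 [tuple]) //= cats0 big1 ?addr0 // => t.
  by rewrite tuple0.
rewrite big_tupleS; apply: eq_bigr => k _; rewrite IH.
by apply: eq_bigr => t _; rewrite /= catA.
Qed.

Variable m : nat -> R.
Hypothesis m0 : m 0 = 1.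

(** The expected product of the entries that [c] selects in a row, when [m] lists
the moments of the entries. *)
Definition row_weight n (c : {ffun 'I_K -> 'I_n}) : R :=
  \prod_(j < n) m #|[set a | c a == j]|.

(** The factor of one row of the matrix, averaged over its entries. *)
Definition row_op (n : nat) phi : seq nat -> R :=
  fun u => \sum_(c : {ffun 'I_K -> 'I_n}) row_weight c * phi (u ++ row_word c).

Lemma iter_row_op i n phi u : iter i (row_op n) phi u =
  \sum_(C : {ffun 'I_i -> {ffun 'I_K -> 'I_n}})
     (\prod_k row_weight (C k)) * phi (u ++ rows_word C).
Proof.
transitivity (\sum_(t : i.-tuple {ffun 'I_K -> 'I_n})
    (\prod_(c <- t) row_weight c) *
    phi (u ++ flatten [seq row_word c | c : {ffun 'I_K -> 'I_n} <- t])).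
  elim: i u => [|i IH] u.
    rewrite (bigD1 [tuple]) //= big_nil cats0 mul1r big1 ?addr0 // => t.
    by rewrite tuple0.
  rewrite big_tupleS iterS; apply: eq_bigr => c _; rewrite IH mulr_sumr.
  by apply: eq_bigr => t _; rewrite big_cons /= catA mulrA.
rewrite (reindex (fun C : {ffun 'I_i -> {ffun 'I_K -> 'I_n}} => [tuple C k | k < i])) /=.
  apply: eq_bigr => C _; congr (_ * phi (_ ++ flatten _)).
    by rewrite big_map big_enum.
  by rewrite -map_comp.
exists (fun t : i.-tuple {ffun 'I_K -> 'I_n} => [ffun k => tnth t k]) => [C _|t _].
  by apply/ffunP => k; rewrite ffunE tnth_mktuple.
by apply: eq_from_tnth => k; rewrite tnth_mktuple ffunE.
Qed.

Lemma row_op_alt n phi : alternating phi -> alternating (row_op n phi).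
Proof.
move=> alt u a b v; rewrite /row_op mulr_sumr; apply: eq_bigr => c _.
by rewrite -!catA alt mulrCA.
Qed.

(** Set partitions of the colours are encoded by the map sending a colour to the
least colour of its part. *)
Definition least_rep (T : eqType) (c : 'I_K -> T) : {ffun 'I_K -> 'I_K} :=
  [ffun a => [arg min_(b < a | c b == c a) val b]].

Lemma least_repP (T : eqType) (c : 'I_K -> T) a :
  c (least_rep c a) = c a /\ forall b, c b = c a -> (least_rep c a <= b)%N.
Proof.
rewrite ffunE; case: arg_minnP => [|b /eqP cb H]; first exact: eqxx.
by split=> // b' cb'; apply: H; apply/eqP.
Qed.

Lemma least_rep_eq (T : eqType) (c : 'I_K -> T) a b :
  (least_rep c a == least_rep c b) = (c a == c b).
Proof.
have [ca la] := least_repP c a; have [cb lb] := least_repP c b.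
apply/eqP/eqP => [e|e]; first by rewrite -ca e cb.
by apply/val_inj/anti_leq; rewrite la ?lb // ?ca ?cb ?e.
Qed.

Lemma least_rep_id (T : eqType) (c : 'I_K -> T) a :
  least_rep c (least_rep c a) = least_rep c a.
Proof. by apply/eqP; rewrite least_rep_eq; case: (least_repP c a) => ->. Qed.

Lemma least_rep_le (T : eqType) (c : 'I_K -> T) a : (least_rep c a <= a)%N.
Proof. by case: (least_repP c a) => _; apply. Qed.

Definition is_rep (r : {ffun 'I_K -> 'I_K}) :=
  [forall a, (r (r a) == r a) && (r a <= a)%N].

Lemma row_weight_rep n (c : {ffun 'I_K -> 'I_n}) : row_weight c =
  \prod_(x | least_rep c x == x) m #|[set a | least_rep c a == x]|.
Proof.
rewrite /row_weight.
rewrite (bigID (fun j => j \in c @: [set x | least_rep c x == x])) /=.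
rewrite [X in _ * X]big1 ?mulr1 => [|j jn]; last first.
  suff -> : [set a | c a == j] = set0 by rewrite cards0.
  apply/setP => a; rewrite !inE; apply: contraNF jn => /eqP <-.
  apply/imsetP; exists (least_rep c a); first by rewrite inE least_rep_id.
  by case: (least_repP c a).
rewrite (eq_bigl (fun j => j \in c @: [set x | least_rep c x == x])) //.
rewrite big_imset /=; last first.
  move=> x y; rewrite !inE => /eqP xr /eqP yr cxy.
  by rewrite -xr -yr; apply/eqP; rewrite least_rep_eq cxy.
apply: eq_big => [x|x]; rewrite inE // => /eqP xr; congr (m _).
apply: eq_card => a; rewrite !inE -[X in _ = (_ == X)]xr least_rep_eq.
by [].
Qed.

(** The weight of [c] depends only on the partition of the colours into fibres of
[c], so Moebius inversion over partitions writes it as a combination of the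
conditions that [c] be constant on the parts of [r]. *)
Lemma row_weight_zeta : exists h : {ffun 'I_K -> 'I_K} -> R,
  forall n (c : {ffun 'I_K -> 'I_n}),
    row_weight c = \sum_(r | is_rep r && [forall a, c (r a) == c a]) h r.
Proof.
pose le (r q : {ffun 'I_K -> 'I_K}) := is_rep r && [forall a, q (r a) == q a].
pose g (r : {ffun 'I_K -> 'I_K}) : R := \prod_(x | r x == x) m #|[set a | r a == x]|.
have [||h hP] := @zeta_surjective R _ le is_rep
  (fun r : {ffun 'I_K -> 'I_K} => \sum_a (K - r a))%N _ _ g.
- move=> r vr; rewrite /le vr; apply/forallP => a.
  by have /forallP/(_ a)/andP[] := vr.
- move=> r q /forallP vq /andP[/forallP vr /forallP rq] nrq.
  have qr a : (q a <= r a)%N.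
    by rewrite -(eqP (rq a)); case/andP: (vq (r a)).
  have [a ra] : exists a, r a != q a.
    by apply/existsP; apply: contraNT nrq; rewrite negb_exists => /forallP H;
      apply/eqP/ffunP => a; apply/eqP; move: (H a); rewrite negbK.
  rewrite (bigD1 a) //= [X in (_ < X)%N](bigD1 a) //=.
  have := qr a; have := ltn_ord (r a); move: ra; rewrite -val_eqE /=.
  have : (\sum_(i < K | i != a) (K - r i) <= \sum_(i < K | i != a) (K - q i))%N.
    by apply: leq_sum => i _; apply: leq_sub2l.
  by move: (\sum_(i < K | _) _)%N (\sum_(i < K | _) _)%N => x y; lia.
exists h => n c; rewrite row_weight_rep -/(g (least_rep c)) hP; last first.
  by apply/forallP => a; rewrite least_rep_id eqxx least_rep_le.
apply: eq_bigl => r; rewrite /le; congr (_ && _).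
by apply: eq_forallb => a; rewrite least_rep_eq.
Qed.

Definition rep_reps (r : {ffun 'I_K -> 'I_K}) := [seq x <- enum 'I_K | r x == x].
Definition rep_word (r : {ffun 'I_K -> 'I_K}) := [seq [set a | r a == x] | x <- rep_reps r].

Lemma rep_word_perm r : is_rep r ->
  perm_eq (enum 'I_K) (flatten [seq enum B | B : {set 'I_K} <- rep_word r]).
Proof.
move=> /forallP vr; apply/allP => a _ /=.
rewrite count_uniq_mem ?enum_uniq // mem_enum inE count_flatten.
rewrite -!map_comp (eq_map (g := fun x => (r a == x) : nat)); last first.
  by move=> x /=; rewrite count_uniq_mem ?enum_uniq // mem_enum inE.
rewrite sumn_count (eq_count (a2 := pred1 (r a))); last by move=> x /=; rewrite eq_sym.
have Ur : uniq (rep_reps r) by rewrite filter_uniq ?enum_uniq.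
rewrite (count_uniq_mem _ Ur) mem_filter mem_enum andbT.
by have /andP[->] := vr a.
Qed.

(** A map that is constant on the parts of [r] is a choice of one site for every
part, hence a term in a product of power sums. *)
Lemma sum_rep_word r : is_rep r -> exists sg, forall n phi u, alternating phi ->
  \sum_(c : {ffun 'I_K -> 'I_n} | [forall a, c (r a) == c a])
     phi (u ++ row_word c) = sg * word_op n phi (rep_word r) u.
Proof.
move=> vr; have [sg sgP] := alternating_perm R (rep_word_perm vr).
exists sg => n phi u alt; rewrite word_op_tuple mulr_sumr.
have ix a : (index (r a) (rep_reps r) < size (rep_reps r))%N.
  rewrite index_mem mem_filter mem_enum andbT.
  by have /forallP/(_ a)/andP[] := vr.
pose ct (t : (size (rep_reps r)).-tuple 'I_n) :=
  [ffun a => tnth t (Ordinal (ix a))] : {ffun 'I_K -> 'I_n}.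
have Ux : uniq (rep_reps r) by rewrite filter_uniq ?enum_uniq.
pose x0 := tnth (in_tuple (rep_reps r)).
have rx0 i : r (x0 i) = x0 i.
  by have := mem_tnth i (in_tuple (rep_reps r)); rewrite mem_filter => /andP[/eqP].
have ixx0 i : index (x0 i) (rep_reps r) = i.
  by rewrite /x0 (tnth_nth (x0 i)) index_uniq.
have ctx0 t i : ct t (x0 i) = tnth t i.
  by rewrite ffunE; congr tnth; apply: val_inj; rewrite /= rx0 ixx0.
have ctr t a : ct t a = ct t (r a).
  have /forallP/(_ a)/andP[/eqP ra _] := vr.
  by rewrite !ffunE; congr tnth; apply: val_inj; rewrite /= ra.
have ctE (t : (size (rep_reps r)).-tuple 'I_n) :
   flatten [seq block [set a | r a == x.1] x.2 |
     x : 'I_K * 'I_n <- zip (rep_reps r) t]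
   = [seq (ct t a * K + a)%N |
      a : 'I_K <- flatten [seq enum B | B : {set 'I_K} <- rep_word r]].
  rewrite map_flatten -!map_comp; congr flatten.
  have -> : zip (rep_reps r) t = [seq (x0 i, tnth t i) | i <- enum 'I_(size (rep_reps r))].
    by rewrite -zip_map map_tnth_enum (map_tnth_enum (in_tuple (rep_reps r))).
  have E (F : 'I_K -> seq nat) : [seq F x | x <- rep_reps r] =
      [seq F (x0 i) | i <- enum 'I_(size (rep_reps r))].
    by rewrite (map_comp F x0) map_tnth_enum.
  rewrite E -map_comp.
  apply: eq_map => i /=; apply/eq_in_map => a; rewrite mem_enum inE => /eqP ra.
  by rewrite ctr ra ctx0.
rewrite (reindex ct) /=; last first.
  exists (fun c => [tuple of map c (in_tuple (rep_reps r))]) => [t _|c].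
    by apply: eq_from_tnth => i; rewrite tnth_map ctx0.
  rewrite inE => /forallP cr; apply/ffunP => a.
  rewrite ffunE tnth_map (tnth_nth (r a)) /= nth_index ?(eqP (cr a)) //.
  by rewrite -index_mem.
apply: eq_big => t.
  by apply/forallP => a; rewrite -ctr.
move=> _; rewrite ctE.
have := sgP phi (fun a => ct t a * K + a)%N u [::] alt.
by rewrite !cats0 => <-.
Qed.

(** Every partition of the colours contributes a multiple of the product of the
power sums of its parts; the coefficients do not depend on the number of sites. *)
Lemma row_op_words : exists ker : seq (R * seq {set 'I_K}),
  (forall x, x \in ker -> set0 \notin x.2 /\ (\sum_(S <- x.2) #|S| = K)%N) /\
  forall n phi u, alternating phi ->
    row_op n phi u = \sum_(x <- ker) x.1 * word_op n phi x.2 u.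
Proof.
have [h hP] := row_weight_zeta.
have /fin_all_exists[sg sgP] (r : {ffun 'I_K -> 'I_K}) : exists sg,
  is_rep r -> forall n phi u, alternating phi ->
  \sum_(c : {ffun 'I_K -> 'I_n} | [forall a, c (r a) == c a])
     phi (u ++ row_word c) = sg * word_op n phi (rep_word r) u.
  case vr: (is_rep r); last by exists 0.
  by have [sg] := sum_rep_word vr; exists sg.
exists [seq (h r * sg r, rep_word r) | r <- enum is_rep]; split.
  move=> x /mapP[r]; rewrite mem_enum => vr -> /=; split.
    apply/mapP => -[y]; rewrite mem_filter => /andP[/eqP ry _].
    by move/setP/(_ y); rewrite !inE ry eqxx.
  rewrite -[RHS]size_enum_ord (perm_size (rep_word_perm vr)).
  rewrite size_flatten /shape -map_comp.
  by rewrite sumnE big_map; apply: eq_bigr => S _; rewrite /= cardE.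
move=> n phi u alt; rewrite /row_op big_map big_enum /=.
under eq_bigr do rewrite hP mulr_suml.
rewrite (exchange_big_dep is_rep) /=; last by move=> c r _ /andP[].
apply: eq_bigr => r vr; rewrite -mulrA -sgP // mulr_sumr.
by apply: eq_bigl => c; rewrite vr.
Qed.

End Rows.

(** * Values of words of power sums *)

(** All Boolean lists of length [k]; each stands for a splitting of a word into
two subwords. *)
Fixpoint masks (k : nat) : seq (seq bool) :=
  if k is k'.+1 then
    [seq false :: b | b <- masks k'] ++ [seq true :: b | b <- masks k']
  else [:: [::]].

Lemma size_masks k b : b \in masks k -> size b = k.
Proof.
elim: k b => [|k IH] b /=; first by rewrite inE => /eqP ->.
by rewrite mem_cat => /orP[] /mapP[b' /IH <- ->].
Qed.

Lemma masks_cons k : masks k = nseq k false :: behead (masks k).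
Proof. by elim: k => //= k ->. Qed.

Lemma behead_masks k b : b \in behead (masks k) -> true \in b.
Proof.
elim: k b => //= k IH b; rewrite {1}masks_cons /= mem_cat.
case/orP => /mapP[b'] tb ->; rewrite inE ?eqxx //.
by rewrite (IH _ tb).
Qed.

Lemma big_masksS (V : nmodType) k (F : seq bool -> V) :
  \sum_(b <- masks k.+1) F b =
  \sum_(b <- masks k) F (false :: b) + \sum_(b <- masks k) F (true :: b).
Proof. by rewrite /= big_cat !big_map. Qed.

Lemma big_masks_add (V : nmodType) k l (F : seq bool -> V) :
  \sum_(b <- masks (k + l)) F b =
  \sum_(b <- masks k) \sum_(c <- masks l) F (b ++ c).
Proof.
elim: k F => [|k IH] F; first by rewrite /= big_seq1.
by rewrite addSn !big_masksS !IH.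
Qed.

Section WordValues.
Variables (R : realFieldType) (K : nat).
Implicit Types (phi psi : seq nat -> R) (S T : {set 'I_K}) (s t : seq {set 'I_K}).

Definition weight s := (\sum_(S <- s) #|S|)%N.

Lemma weight_cat s t : weight (s ++ t) = (weight s + weight t)%N.
Proof. exact: big_cat. Qed.

Lemma weight_cons S s : weight (S :: s) = (#|S| + weight s)%N.
Proof. exact: big_cons. Qed.

(** The coefficient of the top monomial of the Grassmann algebra on [n] sites in
the product of the power sums of the letters of [s]. *)
Definition word_val n s : R := word_op n (@word_sign R (n * K)) s [::].

Lemma word_op_size M n s u :
  (size u + weight s)%N <> M -> word_op n (@word_sign R M) s u = 0.
Proof.
elim: s u => [|S s IH] u /=.
  rewrite /weight big_nil addn0 /word_sign; case: ifP => // /perm_size.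
  by rewrite size_iota.
rewrite weight_cons addnA => H; rewrite /letter_op big1 // => k _.
by apply: IH; rewrite size_cat size_block.
Qed.

Lemma letter_opC n S T phi : alternating phi -> forall u,
  letter_op n S (letter_op n T phi) u =
  (-1) ^+ (#|S| * #|T|) * letter_op n T (letter_op n S phi) u.
Proof.
move=> alt u; rewrite /letter_op exchange_big mulr_sumr /=.
apply: eq_bigr => k _; rewrite mulr_sumr; apply: eq_bigr => l _.
have := alt u (block S l) (block T k) [::].
by rewrite !cats0 -!catA !size_block => ->.
Qed.

Lemma letter_op_ext n S phi psi c : (forall u, phi u = c * psi u) ->
  forall u, letter_op n S phi u = c * letter_op n S psi u.
Proof. by move=> e u; rewrite /letter_op mulr_sumr; apply: eq_bigr => k _. Qed.

Lemma letter_word_opC n S s phi : alternating phi -> forall u,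
  word_op n phi (S :: s) u =
  (-1) ^+ (#|S| * weight s) * word_op n (letter_op n S phi) s u.
Proof.
move=> alt; elim: s => [|T s IH] u /=.
  by rewrite /weight big_nil muln0 mul1r.
rewrite letter_opC; last exact: word_op_alt.
rewrite (letter_op_ext n T IH) mulrA -exprD weight_cons mulnDr.
by [].
Qed.

Lemma word_op_linear n s phi psi c : (forall u, phi u = c * psi u) ->
  forall u, word_op n phi s u = c * word_op n psi s u.
Proof.
move=> e; elim: s => [|S s IH] u //=.
exact: letter_op_ext.
Qed.

Definition even_letter S := (S != set0) && ~~ odd #|S|.
Definition odd_letter S := odd #|S|.

Lemma weight_even s : all even_letter s -> ~~ odd (weight s).
Proof.
elim: s => [|S s IH] /=; first by rewrite /weight big_nil.
by case/andP => /andP[_ eS] /IH; rewrite weight_cons oddD (negbTE eS).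
Qed.

Lemma word_op_even_letter n S s t phi : even_letter S -> alternating phi ->
  word_op n phi (S :: s ++ t) =1 word_op n phi (s ++ S :: t).
Proof.
move=> /andP[_ /negbTE eS] alt u; rewrite -cat_cons word_op_cat.
rewrite letter_word_opC; last exact: word_op_alt.
rewrite -signr_odd oddM eS mul1r word_op_cat.
by [].
Qed.

(** Even letters are central, so they can be collected in front. *)
Lemma word_op_sort n s phi : alternating phi -> set0 \notin s ->
  word_op n phi s =1
    word_op n phi ([seq S <- s | even_letter S] ++ [seq S <- s | odd_letter S]).
Proof.
move=> alt; elim: s => [|S s IH] //=.
rewrite inE negb_or eq_sym => /andP[S0 /IH{}IH] u.
have {}IH u' : word_op n phi (S :: s) u' = word_op n phi (S ::
   [seq S <- s | even_letter S] ++ [seq S <- s | odd_letter S]) u'.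
  by rewrite /= /letter_op; apply: eq_bigr => k _; rewrite IH.
rewrite -[LHS]/(word_op n phi (S :: s) u) IH /even_letter S0 /= /odd_letter.
case oS: (odd #|S|) => //=.
rewrite -[LHS]/(word_op n phi (S :: (_ ++ _)) u) -cat_cons word_op_cat.
rewrite letter_word_opC; last exact: word_op_alt.
rewrite -signr_odd oddM.
rewrite (negbTE (weight_even _)) ?andbF ?mul1r ?word_op_cat //.
by apply/allP => T; rewrite mem_filter => /andP[].
Qed.

Lemma word_op_even_perm n s1 s2 t phi : alternating phi -> all even_letter s1 ->
  perm_eq s1 s2 -> word_op n phi (s1 ++ t) =1 word_op n phi (s2 ++ t).
Proof.
move=> alt e1 p12.
pose Q s := all even_letter s /\ word_op n phi (s ++ t) =1 word_op n phi (s1 ++ t).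
suff : Q s2 by case=> _ H u; rewrite H.
apply: (@catCA_perm_ind _ Q _ s1 s2 p12); last by [].
move=> a b c []; rewrite !all_cat => /and3P[ea eb ec] H; split.
  by rewrite !all_cat ea eb.
move=> u; rewrite -H {H} -!catA.
elim: a ea u => [|S a IH] //= /andP[eS /IH{}IH] u.
transitivity (word_op n phi (S :: b ++ a ++ c ++ t) u).
  by rewrite word_op_even_letter.
by rewrite /= /letter_op; apply: eq_bigr => k _; rewrite IH.
Qed.

(** An odd letter anticommutes with itself. *)
Lemma word_op_odd_dup n s phi : alternating phi ->
  all odd_letter s -> ~~ uniq s -> word_op n phi s =1 (fun=> 0).
Proof.
move=> alt os us.
have zz psi : (forall u, psi u = 0) -> forall t u, word_op n psi t u = 0.
  move=> H t; elim: t => [|T t IH] u //=.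
  by rewrite /letter_op big1 // => k _; rewrite IH.
elim: s os us => [|S s IH] //= /andP[oS os].
rewrite negb_and negbK => /orP[|us u]; last first.
  by rewrite /letter_op big1 // => k _; rewrite IH.
move=> Ss; case/splitPr: Ss => s' t u.
rewrite -[LHS]/(word_op n phi (S :: (s' ++ S :: t)) u) -cat_cons word_op_cat.
rewrite letter_word_opC; last exact: word_op_alt.
rewrite zz ?mulr0 // => v /=.
have alt' := word_op_alt n t alt.
have := letter_opC n S S alt' v.
rewrite -signr_odd oddM (oS : odd #|S|) /= => e.
by move: e; rewrite expr1 mulN1r => e; lra.
Qed.

(** ** Splitting off the last site *)

(** The Koszul sign of moving the letters selected by [b] behind the others. *)
Fixpoint mask_sign (b : seq bool) s : R :=
  match b, s with
  | true :: b', T :: s' =>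
      (-1) ^+ (#|T| * weight (mask (map negb b') s')) * mask_sign b' s'
  | false :: b', _ :: s' => mask_sign b' s'
  | _, _ => 1
  end.

Lemma mask_sign_even b c s t : all even_letter s -> size b = size s ->
  mask_sign (b ++ c) (s ++ t) = mask_sign c t.
Proof.
elim: s b => [|S s IH] [|x b] //= /andP[/andP[_ /negbTE eS] es] [sz].
by rewrite IH //; case: x; rewrite // -signr_odd oddM eS mul1r.
Qed.

Definition site_word k s := flatten [seq block T k | T <- s].

(** Every letter is a sum of its part on the first [n] sites and its part on the
last one; [mask b s] collects the letters put on the last site. *)
Lemma word_op_lastS n s phi : alternating phi -> forall u,
  word_op n.+1 phi s u = \sum_(b <- masks (size s)) mask_sign b s *
    word_op n (fun v => phi (v ++ site_word n (mask b s))) (mask (map negb b) s) u.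
Proof.
move=> alt; elim: s => [|S s IH] u.
  by rewrite /= big_seq1 /= mul1r /site_word /= cats0.
rewrite big_masksS /= {1}/letter_op big_ord_recr /=; congr (_ + _).
  under eq_bigr do rewrite IH.
  rewrite exchange_big /=; apply: eq_bigr => b _.
  by rewrite /letter_op mulr_sumr.
rewrite IH; apply: eq_bigr => b _; rewrite -!mulrA mulrCA; congr (_ * _).
have E psi t v : alternating psi -> word_op n psi t (v ++ block S n) =
    (-1) ^+ (#|S| * weight t) * word_op n (fun w => psi (w ++ block S n)) t v.
  move=> altpsi; elim: t v => [|T t IHt] v /=.
    by rewrite /weight big_nil muln0 mul1r.
  rewrite /letter_op mulr_sumr; apply: eq_bigr => k _.
  have := word_op_alt n t altpsi v (block S n) (block T k) [::].
  rewrite !cats0 catA => ->; rewrite [_ ++ block T k ++ _]catA IHt mulrA -exprD.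
  by rewrite !size_block weight_cons mulnDr.
rewrite E.
  congr (_ * _); apply: word_op_ext => v.
  by rewrite /site_word /= -!catA.
move=> u' a c v; rewrite -!catA; exact: alt.
Qed.

Lemma block_lt n S (k : 'I_n) : all (fun x => x < n * K)%N (block S k).
Proof.
apply/allP => x /mapP[a _ ->].
have := ltn_ord k; have := ltn_ord a; nia.
Qed.

Lemma word_op_small n s phi psi c :
  (forall u, all (fun x => x < n * K)%N u -> phi u = psi u * c) ->
  forall u, all (fun x => x < n * K)%N u ->
    word_op n phi s u = word_op n psi s u * c.
Proof.
move=> e; elim: s => [|S s IH] u su /=; first exact: e.
rewrite /letter_op mulr_suml; apply: eq_bigr => k _; apply: IH.
by rewrite all_cat su block_lt.
Qed.

Lemma word_val1 s : word_val 1 s = @word_sign R K (site_word 0 s).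
Proof.
rewrite /word_val mul1n -[site_word 0 s]cat0s; elim: s [::] => [|S s IH] u /=.
  by rewrite cats0.
by rewrite /letter_op big_ord1 IH catA.
Qed.

(** The last site has [K] generators of its own, so what it receives splits off as
a factor. *)
Lemma word_valS n s : word_val n.+1 s = \sum_(b <- masks (size s))
  mask_sign b s * (word_val n (mask (map negb b) s) * word_val 1 (mask b s)).
Proof.
rewrite /word_val word_op_lastS; last exact: word_sign_alt.
apply: eq_bigr => b _; congr (_ * _).
apply: word_op_small => // u su.
rewrite -/(word_val 1 _) word_val1 mulSnr word_sign_cat //.
  congr (_ * word_sign _ _ _).
  rewrite /site_word map_flatten -map_comp; congr flatten.
  apply: eq_map => S /=; rewrite /block -map_comp; apply: eq_map => a /=.
  by rewrite mul0n add0n addnC addnK.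
by apply/allP => x /flattenP[_ /mapP[S _ ->] /mapP[a _ ->]]; apply: leq_addr.
Qed.

Lemma word_val0 s : word_val 0 s = (s == [::])%:R.
Proof.
case: s => [|S s]; last by rewrite /word_val /= /letter_op big_ord0.
by rewrite /word_val /= mul0n (word_sign_iota R 0).
Qed.

(** At a single site the colours of [S] would occur twice. *)
Lemma word_val1_dup S s : S != set0 -> word_val 1 (S :: S :: s) = 0.
Proof.
move=> /set0Pn[a aS]; rewrite word_val1 /word_sign; case: ifP => // p.
have : uniq (site_word 0 (S :: S :: s)) by rewrite (perm_uniq p) iota_uniq.
rewrite /site_word /= cat_uniq => /and3P[_ /hasPn/(_ (0 * K + a)%N)] H _.
have aB : (0 * K + a)%N \in block S 0 by apply: map_f; rewrite mem_enum.
by move: H; rewrite mem_cat aB => /(_ isT) /negP[].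
Qed.

End WordValues.

(** * A pairing of polynomials *)

Section Pairing.
Variables (R : realFieldType) (L : finType).

Let N := #|{: L * bool}|.
Local Notation Q := (mpoly N R).
Implicit Types (p q : Q) (i j : L * bool) (w : seq L) (m : multinom N).

(** Every letter [l] has two variables, [(l, false)] and [(l, true)]. *)
Definition var i : Q := mpolyX R (mnm1 (enum_rank i)).
Definition der i p : Q := mderiv (enum_rank i) p.
Definition dual i := (i.1, ~~ i.2).

Lemma dualK i : dual (dual i) = i.
Proof. by case: i => l b; rewrite /dual /= negbK. Qed.

Lemma derM i p q : der i (p * q) = der i p * q + p * der i q.
Proof. exact: mderivM. Qed.

Lemma derD i p q : der i (p + q) = der i p + der i q.
Proof. exact: mderivD. Qed.

Lemma derB i p q : der i (p - q) = der i p - der i q.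
Proof. exact: mderivB. Qed.

Lemma derZ i c p : der i (c *: p) = c *: der i p.
Proof. exact: mderivZ. Qed.

Lemma der0 i : der i 0 = 0.
Proof. exact: mderiv0. Qed.

Lemma der1 i : der i 1 = 0.
Proof. by rewrite /der -(mpolyC1 N R) mderivC. Qed.

Lemma derC i j p : der i (der j p) = der j (der i p).
Proof. exact: mderiv_comm. Qed.

Lemma der_sum i (I : Type) (r : seq I) (P : pred I) (F : I -> Q) :
  der i (\sum_(x <- r | P x) F x) = \sum_(x <- r | P x) der i (F x).
Proof. exact: linear_sum. Qed.

Lemma der_var i j : der i (var j) = (i == j)%:R.
Proof.
rewrite /der /var mderivX mnm1E [in LHS](inj_eq enum_rank_inj) eq_sym.
case: eqP => [->|_]; last by rewrite scale0r.
by rewrite scale1r -{1}[mnm1 _]add0m addmK mpolyX0.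
Qed.

Definition pairing_mon m : R := \prod_(l : L)
  (if m (enum_rank (l, false)) == m (enum_rank (l, true))
   then (m (enum_rank (l, false)))`!%:R else 0).

(** The linear functional under which multiplication by a variable and
differentiation by the dual variable agree: the two halves of the variables are
paired by letting one half differentiate the other, at the origin. *)
Definition pairing p : R := \sum_(m <- msupp p) mcoeff m p * pairing_mon m.

Lemma pairingE d p : (msize p <= d)%N ->
  pairing p = \sum_(m : bmultinom N d) mcoeff m p * pairing_mon m.
Proof.
move=> le_pd; rewrite /pairing.
rewrite (big_mksub (bmultinom N d)) //=; first last.
- by move=> x /msize_mdeg_lt /leq_trans; apply.
- by rewrite msupp_uniq.
rewrite big_rmcond //= => m; move/memN_msupp_eq0 ->; exact: mul0r.
Qed.

Lemma pairing_is_linear : scalar pairing.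
Proof.
move=> c p q; pose d := maxn (msize (c *: p + q)) (maxn (msize p) (msize q)).
rewrite !(@pairingE d) ?leq_max ?leqnn ?orbT //.
rewrite mulr_sumr -big_split /=.
by apply: eq_bigr => m _; rewrite mcoeffD mcoeffZ mulrDl mulrA.
Qed.
HB.instance Definition _ := GRing.isLinear.Build R Q R *%R pairing pairing_is_linear.

Lemma pairing_X m : pairing (mpolyX R m) = pairing_mon m.
Proof. by rewrite /pairing msuppX big_seq1 mcoeffX eqxx mul1r. Qed.

Lemma pairing_var i p : pairing (var i * p) = pairing (der (dual i) p).
Proof.
rewrite [p]mpolyE mulr_sumr der_sum !linear_sum /=; apply: eq_bigr => m _.
rewrite -scalerAr /var -mpolyXD derZ /der mderivX !linearZ /=.
congr (_ * _); rewrite !pairing_X /pairing_mon.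
case: i => l b.
rewrite (bigD1 l) //= [in RHS](bigD1 l) //= mulrA; congr (_ * _); last first.
  apply: eq_bigr => l' nl; rewrite !mnmDE !mnmBE !mnm1E !(inj_eq enum_rank_inj).
  by rewrite !xpair_eqE ![l == _]eq_sym !(negbTE nl) !add0n !subn0.
rewrite !mnmDE !mnmBE !mnm1E !(inj_eq enum_rank_inj) !xpair_eqE !eqxx /=.
case: b => /=; rewrite ?add0n ?add1n ?subn0 ?subn1.
  case: (m (enum_rank (l, false))) => [|k]; first by rewrite mul0r.
  rewrite /= eqSS; case: eqP => [_|_]; last by rewrite mulr0.
  by rewrite factS natrM.
case: (m (enum_rank (l, true))) => [|k]; first by rewrite mul0r.
rewrite /= eqSS; case: eqP => [<-|_]; last by rewrite mulr0.
by rewrite factS natrM.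
Qed.

(** Polynomials in the second half of the variables. *)
Definition zpoly p := forall l, der (l, false) p = 0.

Lemma zpoly1 : zpoly 1. Proof. by move=> l; apply: der1. Qed.
Lemma zpoly0 : zpoly 0. Proof. by move=> l; apply: der0. Qed.

Lemma zpolyM p q : zpoly p -> zpoly q -> zpoly (p * q).
Proof. by move=> zp zq l; rewrite derM zp zq mul0r mulr0 addr0. Qed.

Lemma zpolyZ c p : zpoly p -> zpoly (c *: p).
Proof. by move=> zp l; rewrite derZ zp scaler0. Qed.

Lemma zpoly_sum (I : Type) (r : seq I) (P : pred I) (F : I -> Q) :
  (forall x, zpoly (F x)) -> zpoly (\sum_(x <- r | P x) F x).
Proof. by move=> zF l; rewrite der_sum big1 // => x _; apply: zF. Qed.

Lemma zpoly_der l p : zpoly p -> zpoly (der (l, true) p).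
Proof. by move=> zp l'; rewrite derC zp der0. Qed.

Lemma zpoly_var l : zpoly (var (l, true)).
Proof. by move=> l'; rewrite der_var xpair_eqE andbF. Qed.

(** With nothing to differentiate, only the value at the origin is left. *)
Lemma pairing_zpoly p : zpoly p -> pairing p = mcoeff (@mnm0 N) p.
Proof.
move=> zp.
have H m : m \in msupp p -> m != (@mnm0 N) -> pairing_mon m = 0.
  move=> mp m0.
  have nm l : m (enum_rank (l, false)) = 0%N.
    apply/eqP; apply: contraT => nz.
    move: mp; rewrite mcoeff_msupp => /negP[].
    have /(congr1 (mcoeff (mnm_sub m (mnm1 (enum_rank (l, false)))))) := zp l.
    rewrite mcoeff_deriv mcoeff0 submK; last by rewrite lep1mP.
    by move/eqP; rewrite mulrn_eq0.
  have [l nl] : exists l, m (enum_rank (l, true)) != 0%N.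
    apply/existsP; apply: contraT; rewrite negb_exists => /forallP H.
    case/eqP: m0; apply/mnmP => k; rewrite mnm0E -(enum_valK k).
    case: (enum_val k) => l []; last exact: nm.
    by move: (H l); rewrite negbK => /eqP.
  by rewrite /pairing_mon (bigD1 l) //= nm eq_sym (negbTE nl) mul0r.
have [p0|p0] := boolP ((@mnm0 N) \in msupp p).
  rewrite /pairing (bigD1_seq (@mnm0 N)) ?msupp_uniq //= big_seq_cond.
  rewrite big1 ?addr0 => [|m /andP[mp m0]]; last by rewrite H ?mulr0.
  by rewrite /pairing_mon big1 ?mulr1 // => l _; rewrite !mnm0E eqxx.
rewrite (memN_msupp_eq0 p0) /pairing big_seq big1 // => m mp.
by rewrite H ?mulr0 //; apply: contraNneq p0 => <-.
Qed.

(** The monomial that stores a word of even letters. *)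
Definition yword w : Q := \prod_(l <- w) var (l, false).

Lemma yword_cat w w' : yword (w ++ w') = yword w * yword w'.
Proof. exact: big_cat. Qed.

Lemma yword_cons l w : yword (l :: w) = var (l, false) * yword w.
Proof. exact: big_cons. Qed.

Lemma pairing_yword_cons l w p :
  pairing (yword (l :: w) * p) = pairing (yword w * der (l, true) p).
Proof.
rewrite yword_cons -mulrA pairing_var /dual /= derM.
suff -> : der (l, true) (yword w) = 0 by rewrite mul0r add0r.
elim: w => [|x w IH]; first by rewrite /yword big_nil der1.
by rewrite yword_cons derM IH mulr0 der_var xpair_eqE andbF mul0r addr0.
Qed.

(** Leibniz' rule. *)
Lemma pairing_ywordM w p q : zpoly p -> zpoly q ->
  pairing (yword w * (p * q)) = \sum_(b <- masks (size w))
    pairing (yword (mask (map negb b) w) * p) * pairing (yword (mask b w) * q).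
Proof.
elim: w p q => [|l w IH] p q zp zq.
  rewrite big_seq1 /= /yword big_nil !mul1r !pairing_zpoly //; last exact: zpolyM.
  exact: (rmorphM (mcoeff (@mnm0 N))).
rewrite pairing_yword_cons derM mulrDr linearD /= IH //; last exact: zpoly_der.
rewrite IH //; last exact: zpoly_der.
rewrite (big_masksS (size w)) /=; congr (_ + _); apply: eq_bigr => b _.
  by rewrite /= pairing_yword_cons.
by rewrite /= pairing_yword_cons.
Qed.

Definition zset (d : {set L}) : Q := \prod_(l in d) var (l, true).

Lemma zpoly_zset d : zpoly (zset d).
Proof.
rewrite /zset; elim/big_rec: _ => [|l p _ zp]; first exact: zpoly1.
by apply: zpolyM => //; apply: zpoly_var.
Qed.

Lemma der_zset l d :
  der (l, true) (zset d) = if l \in d then zset (d :\ l) else 0.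
Proof.
have H (d' : {set L}) : l \notin d' -> der (l, true) (zset d') = 0.
  move=> ld; rewrite /zset; elim/big_rec: _ => [|x p xd zp]; first exact: der1.
  rewrite derM zp mulr0 addr0 der_var xpair_eqE andbT.
  by case: eqP xd ld => [->|_ _ _]; rewrite ?mul0r // => ->.
case: ifP => [ld|/negbT]; last exact: H.
rewrite {1}/zset (big_setD1 l) //= derM der_var eqxx mul1r -/(zset _).
by rewrite H ?mulr0 ?addr0 // !inE eqxx.
Qed.

(** The squarefree monomial of [d] records whether a word lists [d]. *)
Lemma pairing_zset w d :
  pairing (yword w * zset d) = (uniq w && ([set l in w] == d))%:R.
Proof.
elim: w d => [|l w IH] d.
  rewrite /yword big_nil mul1r pairing_zpoly; last exact: zpoly_zset.
  have -> : [set l in [::]] = set0 :> {set L} by apply/setP => x; rewrite !inE.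
  rewrite eq_sym; have [->|[x xd]] := set_0Vmem d.
    by rewrite /zset big_set0 mcoeff1 !eqxx.
  rewrite /zset (big_setD1 x) //=.
  rewrite (rmorphM (mcoeff (@mnm0 N))) /= mcoeffX mnm1_eq0 mul0r.
  by case: eqP => // d0; rewrite d0 inE in xd.
rewrite pairing_yword_cons der_zset /=.
case: ifP => ld; last first.
  rewrite mulr0 linear0; case: eqP => [e|_]; last by rewrite andbF.
  by rewrite -e !inE eqxx in ld.
rewrite IH; congr (_%:R); congr nat_of_bool.
case uw: (uniq w); rewrite ?andbF //= andbT.
apply/eqP/andP => [e|[lw /eqP <-]].
  split; first by move/setP/(_ l): e; rewrite !inE eqxx => ->.
  apply/eqP/setP => x; rewrite !inE; have [->|xl] := eqVneq x l.
    by rewrite ld.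
  by move/setP/(_ x): e; rewrite !inE xl.
by apply/setP => x; rewrite !inE; case: eqP => // ->; apply: negbTE.
Qed.

End Pairing.

(** * Generating polynomials of the two index sets *)

Section GeneratingPolynomials.
Variables (R : realFieldType) (K : nat).
Local Notation L := {set 'I_K}.
Local Notation Q := (mpoly #|{: L * bool}| R).
Local Notation word_val := (@word_val R K).
Implicit Types (w s o t : seq L) (d : {set L}).

(** All ways to spend the colours of one site, given that it also receives the
odd letters [t]; a repeated even letter contributes nothing, so a set of even
letters is enough. *)
Definition site_poly t : Q := \sum_(d : {set L} | all (@even_letter K) (enum d))
  word_val 1 (enum d ++ t) *: zset R d.

Lemma word_val_even_perm n s1 s2 t : all (@even_letter K) s1 -> perm_eq s1 s2 ->
  word_val n (s1 ++ t) = word_val n (s2 ++ t).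
Proof. by move=> e p; apply: word_op_even_perm => //; apply: word_sign_alt. Qed.

Lemma pairing_site_poly w t : all (@even_letter K) w ->
  pairing (yword R w * site_poly t) = word_val 1 (w ++ t).
Proof.
move=> ew; rewrite /site_poly mulr_sumr linear_sum /=.
under eq_bigr => d _ do rewrite -scalerAr linearZ /= pairing_zset.
have [uw|nuw] := boolP (uniq w).
  have pw : perm_eq (enum [set l in w]) w.
    by apply: uniq_perm; rewrite ?enum_uniq // => x; rewrite mem_enum inE.
  rewrite (bigD1 [set l in w]) /=; last by rewrite (perm_all _ pw).
  rewrite eqxx mulr1 big1 ?addr0 => [|d /andP[_ /negbTE nd]]; last first.
    by rewrite eq_sym nd mulr0.
  by apply: word_val_even_perm => //; rewrite (perm_all _ pw).
rewrite big1 => [|d _]; last by rewrite mulr0.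
have [S [w' pw]] : exists S w', perm_eq w (S :: S :: w').
  elim: w nuw {ew} => //= S w IH; rewrite negb_and negbK => /orP[Sw|/IH[T [w' p]]].
    by exists S, (rem S w); rewrite perm_cons perm_to_rem.
  exists T, (S :: w'); rewrite -(perm_cons S) in p; apply: (perm_trans p).
  by rewrite (perm_catCA [:: S] [:: T; T]).
rewrite (word_val_even_perm _ _ ew pw) /= word_val1_dup //.
have /allP/(_ S) : all (@even_letter K) w := ew.
by rewrite (perm_mem pw) inE eqxx => /(_ isT) /andP[].
Qed.

(** The odd word [o] is distributed over the [n] sites, one site at a time; the
even letters are accounted for by the variables. *)
Fixpoint col_poly n o : Q :=
  if n is n'.+1 then
    \sum_(b <- masks (size o)) (mask_sign R b o *:
       (col_poly n' (mask (map negb b) o) * site_poly (mask b o)))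
  else (o == [::])%:R.

Lemma zpoly_site t : zpoly (site_poly t).
Proof. by apply: zpoly_sum => d; apply: zpolyZ; apply: zpoly_zset. Qed.

Lemma zpoly_col n o : zpoly (col_poly n o).
Proof.
elim: n o => [|n IH] o /=.
  by case: eqP => _; [exact: zpoly1 | exact: zpoly0].
apply: zpoly_sum => b; apply: zpolyZ; apply: zpolyM => //; exact: zpoly_site.
Qed.

Lemma all_mask (T : Type) (a : pred T) b (s : seq T) : all a s -> all a (mask b s).
Proof.
elim: s b => [|x s IH] [|[] b] //= /andP[ax /IH H]; rewrite ?ax ?H //.
Qed.

(** Leibniz' rule for the product in [col_poly] matches the splitting of a word
between the last site and the others. *)
Lemma pairing_col_poly n w o : all (@even_letter K) w ->
  pairing (yword R w * col_poly n o) = word_val n (w ++ o).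
Proof.
elim: n w o => [|n IH] w o ew /=.
  rewrite word_val0; case: w ew => [|S w] _ /=.
    rewrite /yword big_nil mul1r pairing_zpoly; last first.
      by case: eqP => _; [exact: zpoly1 | exact: zpoly0].
    by case: eqP => _; rewrite ?mcoeff1 ?eqxx ?mcoeff0.
  rewrite pairing_yword_cons; case: eqP => _; rewrite ?der1 ?der0 mulr0 linear0 //.
rewrite word_valS size_cat big_masks_add exchange_big /=.
rewrite mulr_sumr linear_sum /=; apply: eq_bigr => b _.
rewrite -scalerAr linearZ /= pairing_ywordM; [|exact: zpoly_col|exact: zpoly_site].
rewrite mulr_sumr big_seq [RHS]big_seq; apply: eq_bigr => c /size_masks sc.
rewrite mask_sign_even //; congr (_ * _).
by rewrite IH ?pairing_site_poly ?all_mask // map_cat !mask_cat ?size_map.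
Qed.

Variable ker : seq (R * seq L).
Hypothesis ker0 : forall x, x \in ker -> set0 \notin x.2.

Definition evens s := [seq S <- s | even_letter S].
Definition odds s := [seq S <- s | odd_letter S].

(** The words, with coefficients, in the expansion of [n] averaged rows. *)
Fixpoint row_words (n : nat) : seq (R * seq L) :=
  if n is n'.+1 then
    [seq (x.1 * y.1, x.2 ++ y.2) | x <- ker, y <- row_words n']
  else [:: (1, [::])].

Lemma row_words0 n x : x \in row_words n -> set0 \notin x.2.
Proof.
elim: n x => [|n IH] x /=; first by rewrite inE => /eqP ->.
case/allpairsP => -[y z] /= [/ker0 y0 /IH z0 ->] /=.
by rewrite mem_cat negb_or y0.
Qed.

(** The part with odd word [o] of the expansion of [n] averaged rows, computed row
by row. *)
Fixpoint row_poly n o : Q :=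
  if n is n'.+1 then
    \sum_(x <- ker) (x.1 *: (yword R (evens x.2) *
      if prefix (odds x.2) o then row_poly n' (drop (size (odds x.2)) o) else 0))
  else (o == [::])%:R.

Lemma row_polyE n o : row_poly n o =
  \sum_(x <- row_words n | odds x.2 == o) x.1 *: yword R (evens x.2).
Proof.
elim: n o => [|n IH] o /=.
  rewrite big_mkcond big_seq1 /= eq_sym; case: eqP => // _.
  by rewrite scale1r /yword big_nil.
rewrite [RHS]big_mkcond big_allpairs_dep /=; apply: eq_bigr => x _.
transitivity (\sum_(y <- row_words n | odds (x.2 ++ y.2) == o)
   (x.1 * y.1) *: yword R (evens (x.2 ++ y.2))); last by rewrite -big_mkcond.
rewrite /odds /evens.
under eq_bigr do rewrite filter_cat yword_cat -scalerA scalerAr.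
rewrite -scaler_sumr -mulr_sumr; congr (_ *: (_ * _)).
case: ifP => [/prefixP[o' ->]|np].
  rewrite drop_size_cat // IH; apply: eq_bigl => y.
  by rewrite filter_cat eqseq_cat // eqxx.
rewrite big_pred0 // => y; rewrite filter_cat; apply: contraFF np => /eqP <-.
exact: prefix_prefix.
Qed.

(** The words without repetition, a finite set that contains all odd words of
nonzero value. *)
Definition short_words : seq (seq L) :=
  undup (flatten [seq permutations (enum d) | d : {set L}]).

Lemma mem_short_words o : uniq o -> o \in short_words.
Proof.
move=> uo; rewrite mem_undup; apply/flattenP.
exists (permutations (enum [set l in o])).
  by apply: map_f; rewrite mem_enum.
rewrite mem_permutations uniq_perm ?enum_uniq // => x.
by rewrite mem_enum inE.
Qed.

Variable mom : nat -> R.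
Hypothesis ker_row : forall n phi u, alternating phi ->
  row_op K mom n phi u = \sum_(x <- ker) x.1 * word_op n phi x.2 u.

Lemma iter_row_words i j phi u : alternating phi ->
  iter i (row_op K mom j) phi u =
    \sum_(x <- row_words i) x.1 * word_op j phi x.2 u.
Proof.
move=> alt; elim: i u => [|i IH] u; first by rewrite big_seq1 mul1r.
have alti : alternating (iter i (row_op K mom j) phi).
  by elim: (i) => //= k; apply: row_op_alt.
rewrite iterS ker_row // big_allpairs_dep /=; apply: eq_bigr => x _.
elim: x.2 u => [|S s IHs] u /=.
  by rewrite IH mulr_sumr; apply: eq_bigr => y _; rewrite mulrA.
transitivity (\sum_(k < j) \sum_(y <- row_words i)
   x.1 * y.1 * word_op j phi (s ++ y.2) (u ++ block S k)).
  by rewrite /letter_op mulr_sumr; apply: eq_bigr => k _; rewrite IHs.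
by rewrite exchange_big; apply: eq_bigr => y _; rewrite /letter_op mulr_sumr.
Qed.

(** The [K]-th moment, and its analogue for a rectangular array, as a pairing of
the row polynomials with the column polynomials. *)
Lemma iter_row_pairing i j :
  iter i (row_op K mom j) (word_sign R (j * K)) [::] =
    \sum_(o <- short_words) pairing (row_poly i o * col_poly j o).
Proof.
have alt := word_sign_alt R (j * K).
rewrite iter_row_words //.
transitivity (\sum_(o <- short_words) \sum_(x <- row_words i | odds x.2 == o)
   pairing (x.1 *: yword R (evens x.2) * col_poly j o)); last first.
  by apply: eq_bigr => o _; rewrite row_polyE mulr_suml linear_sum.
under [RHS]eq_bigr do rewrite big_mkcond.
rewrite exchange_big /= big_seq [RHS]big_seq; apply: eq_bigr => x xw.
rewrite word_op_sort ?(row_words0 xw) //.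
have ee : all (@even_letter K) (evens x.2).
  by apply/allP => S; rewrite mem_filter => /andP[].
have eo : all (@odd_letter K) (odds x.2).
  by apply/allP => S; rewrite mem_filter => /andP[].
have [os|os] := boolP (odds x.2 \in short_words).
  rewrite (bigD1_seq (odds x.2)) ?undup_uniq //= eqxx big1 ?addr0; last first.
    by move=> o /negbTE no; rewrite eq_sym no.
  by rewrite -scalerAl linearZ /= pairing_col_poly.
rewrite big_seq big1 => [|o ow]; last by case: eqP => // e; rewrite e ow in os.
have nu : ~~ uniq (odds x.2) by apply: contra os; apply: mem_short_words.
rewrite -/(evens _) -/(odds _) word_op_cat.
have z := word_op_odd_dup j alt eo nu.
by rewrite (word_op_linear (c := 0) _ _ (psi := fun=> 0)) ?mul0r ?mulr0 // => v; rewrite z mul0r.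
Qed.

(** The words come from [i] rows and have weight [i * K], while [j] sites offer
[j * K] generators. *)
Lemma iter_row_size i j : (0 < K)%N -> i <> j ->
  (forall x, x \in ker -> weight x.2 = K) ->
  iter i (row_op K mom j) (word_sign R (j * K)) [::] = 0.
Proof.
move=> K0 ij kerK; rewrite iter_row_words; last exact: word_sign_alt.
rewrite big_seq big1 // => x xw; rewrite word_op_size ?mulr0 //=.
suff -> : weight x.2 = (i * K)%N.
  by rewrite add0n => /eqP; rewrite eqn_pmul2r // => /eqP.
elim: i x xw {ij} => [|i IH] x /=.
  by rewrite inE => /eqP ->; rewrite /weight big_nil.
by case/allpairsP => -[y z] /= [/kerK yK /IH zK ->]; rewrite /= weight_cat yK zK mulSn.
Qed.

End GeneratingPolynomials.

(** * Coefficients of polynomial multiples of an exponential *)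

Section ExpPoly.
Variables (R : realFieldType) (S : comAlgType R).
Implicit Types (p : S) (q : {poly S}) (u : nat -> S).

(** The coefficient of [t ^ n] in [q(t) exp(p t)]. *)
Definition exp_coef p q (n : nat) : S :=
  \sum_(j < n.+1) ((n - j)`!%:R^-1 : R) *: (q`_j * p ^+ (n - j)).

Lemma exp_coef0 p q : exp_coef p q 0 = q`_0.
Proof. by rewrite /exp_coef big_ord1 /= invr1 scale1r mulr1. Qed.

Lemma factS_inv (n : nat) : n.+1%:R * (n.+1`!%:R^-1) = n`!%:R^-1 :> R.
Proof.
by rewrite factS natrM invfM mulrA divff ?mul1r // pnatr_eq0.
Qed.

(** The differential equation of [q(t) exp(p t)], read on coefficients. *)
Lemma exp_coefS p q n : n.+1%:R *: exp_coef p q n.+1 =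
  p * exp_coef p q n + exp_coef p q^`() n.
Proof.
rewrite /exp_coef scaler_sumr mulr_sumr.
under eq_bigr => j _.
  rewrite scalerA -{1}(subnK (ltnSE (ltn_ord j))) natrD mulrDl scalerDl.
over.
rewrite big_split /=; congr (_ + _).
  rewrite big_ord_recr /= subnn mul0r scale0r addr0.
  apply: eq_bigr => j _; rewrite subSn ?(ltnSE (ltn_ord j)) //.
  by rewrite factS_inv exprS -scalerAr mulrCA.
rewrite big_ord_recl /= mul0r scale0r add0r; apply: eq_bigr => j _.
rewrite /bump /= add1n subSS coef_deriv mulrC -scalerA; congr (_ *: _).
by rewrite scaler_nat mulrnAl.
Qed.

Lemma exp_coef_uniq p q u : u 0 = q`_0 ->
  (forall n, n.+1%:R *: u n.+1 = p * u n + exp_coef p q^`() n) ->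
  u =1 exp_coef p q.
Proof.
move=> u0 uS; elim=> [|n IH]; first by rewrite exp_coef0.
have n0 : n.+1%:R != 0 :> R by rewrite pnatr_eq0.
by apply: (scalerI n0); rewrite uS IH exp_coefS.
Qed.

Lemma exp_coefD p q r n : exp_coef p (q + r) n = exp_coef p q n + exp_coef p r n.
Proof.
rewrite /exp_coef -big_split; apply: eq_bigr => j _ /=.
by rewrite coefD mulrDl scalerDr.
Qed.

Lemma exp_coefC p (c : S) q n : exp_coef p (c%:P * q) n = c * exp_coef p q n.
Proof.
rewrite /exp_coef mulr_sumr; apply: eq_bigr => j _ /=.
by rewrite coefCM -scalerAr mulrA.
Qed.

Lemma exp_coef_0 p n : exp_coef p 0 n = 0.
Proof. by rewrite /exp_coef big1 // => j _; rewrite coef0 mul0r scaler0. Qed.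

Lemma exp_coef_sum p (I : Type) (r : seq I) (F : I -> {poly S}) n :
  exp_coef p (\sum_(i <- r) F i) n = \sum_(i <- r) exp_coef p (F i) n.
Proof.
elim: r => [|i r IH]; first by rewrite !big_nil exp_coef_0.
by rewrite !big_cons exp_coefD IH.
Qed.

Lemma exp_coefXn p q k n : exp_coef p ('X^k * q) n =
  if (k <= n)%N then exp_coef p q (n - k) else 0.
Proof.
rewrite /exp_coef; case: leqP => [kn|nk].
  rewrite (eq_bigr (fun j : 'I_n.+1 => if (k <= j)%N then
    ((n - k - (j - k))`!%:R^-1 : R) *: (q`_(j - k) * p ^+ (n - k - (j - k))) else 0)).
    rewrite -big_mkcond /=.
    have -> : n.+1 = (k + (n - k).+1)%N by lia.
    rewrite big_split_ord /= big_pred0 ?add0r => [|i]; last first.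
      by rewrite leqNgt ltn_ord.
    rewrite (eq_bigl xpredT) => [|i]; last by rewrite leq_addr.
    by apply: eq_bigr => i _; rewrite addKn.
  move=> j _; rewrite coefXnM ltnNge; case: leqP => //= kj.
    by rewrite -subnDA subnKC.
  by rewrite mul0r scaler0.
rewrite big1 // => j _; rewrite coefXnM.
by rewrite (leq_trans (ltn_ord j)) // mul0r scaler0.
Qed.

(** Both sides satisfy the same differential equation. *)
Lemma exp_coefM p p' q q' n :
  \sum_(i < n.+1) exp_coef p q i * exp_coef p' q' (n - i) =
  exp_coef (p + p') (q * q') n.
Proof.
elim: n q q' => [|n IH] q q'.
  by rewrite big_ord1 !exp_coef0 coefM big_ord1.
have n0 : n.+1%:R != 0 :> R by rewrite pnatr_eq0.
apply: (scalerI n0); rewrite exp_coefS derivM exp_coefD -!IH.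
have E : n.+1%:R *: (\sum_(i < n.+2) exp_coef p q i * exp_coef p' q' (n.+1 - i)) =
  \sum_(i < n.+1) (i.+1%:R *: exp_coef p q i.+1) * exp_coef p' q' (n - i) +
  \sum_(i < n.+1) exp_coef p q i * ((n - i).+1%:R *: exp_coef p' q' (n - i).+1).
  rewrite scaler_sumr.
  under eq_bigr => j _.
    rewrite -{1}(subnK (ltnSE (ltn_ord j))) addnC natrD scalerDl.
  over.
  rewrite big_split /=; congr (_ + _).
    rewrite big_ord_recl /= scale0r add0r; apply: eq_bigr => j _.
    by rewrite /bump /= add1n subSS scalerAl.
  rewrite big_ord_recr /= subnn scale0r addr0; apply: eq_bigr => j _.
  by rewrite subSn ?(ltnSE (ltn_ord j)) // scalerAr.
rewrite {}E.
under eq_bigr do rewrite exp_coefS mulrDl -mulrA.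
under [X in _ + X = _]eq_bigr do rewrite exp_coefS mulrDr mulrCA.
by rewrite !big_split /= -!mulr_sumr; ring.
Qed.

(** Sequences whose exponential generating function is a polynomial multiple of
[exp(p t)]. *)
Definition quasi_exp p u := exists q, forall n, (n`!%:R^-1 : R) *: u n = exp_coef p q n.

Lemma quasi_exp_0 p : quasi_exp p (fun=> 0).
Proof. by exists 0 => n; rewrite exp_coef_0 scaler0. Qed.

Lemma quasi_exp_ext p u v : u =1 v -> quasi_exp p u -> quasi_exp p v.
Proof. by move=> e [q H]; exists q => n; rewrite -e. Qed.

Lemma quasi_expM p c u : quasi_exp p u -> quasi_exp p (fun n => c * u n).
Proof.
case=> q H; exists (c%:P * q) => n.
by rewrite exp_coefC -H -scalerAr.
Qed.

Lemma quasi_expZ p (c : R) u : quasi_exp p u -> quasi_exp p (fun n => c *: u n).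
Proof.
move=> /(quasi_expM c%:A); apply: quasi_exp_ext => n.
by rewrite -scalerAl mul1r.
Qed.

Lemma quasi_exp_sum p (I : eqType) (r : seq I) (F : I -> nat -> S) :
  (forall i, i \in r -> quasi_exp p (F i)) ->
  quasi_exp p (fun n => \sum_(i <- r) F i n).
Proof.
elim: r => [|i r IH] H.
  by apply: quasi_exp_ext (quasi_exp_0 p) => n; rewrite big_nil.
have [q qP] := H i (mem_head _ _).
have [|q' qP'] := IH; first by move=> j jr; apply: H; rewrite inE jr orbT.
by exists (q + q') => n; rewrite big_cons exp_coefD -qP -qP' scalerDr.
Qed.

(** Variation of constants. *)
Lemma quasi_exp_rec p u v : (forall n, u n.+1 = p * u n + v n) ->
  quasi_exp p v -> quasi_exp p u.
Proof.
move=> uS [q qP].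
pose Q := \poly_(i < (size q).+1) (if i is i'.+1 then (i'.+1%:R^-1 : R) *: q`_i' else u 0).
have Q0 : Q`_0 = u 0 by rewrite coef_poly.
have dQ : Q^`() = q.
  apply/polyP => i; rewrite coef_deriv coef_poly ltnS; case: ltnP => iq.
    by rewrite -scaler_nat scalerA divff ?scale1r // pnatr_eq0.
  by rewrite mul0rn nth_default.
exists Q; apply: exp_coef_uniq => [|n]; first by rewrite Q0 invr1 scale1r.
by rewrite dQ -qP scalerA factS_inv uS scalerDr scalerAr.
Qed.

End ExpPoly.

Section QuasiExpPolys.
Variables (R : realFieldType) (K : nat).
Local Notation L := {set 'I_K}.
Local Notation Q := (mpoly #|{: L * bool}| R).

Lemma size_mask_lt (T : Type) b (s : seq T) : size b = size s -> true \in b ->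
  (size (mask (map negb b) s) < size s)%N.
Proof.
elim: b s => [|[] b IH] [|x s] //= [sz]; rewrite inE /= => tb.
  by rewrite ltnS size_mask ?size_map // count_map -sz count_size.
by rewrite ltnS; apply: IH.
Qed.

(** Only the empty mask leaves the odd word unchanged, so the recurrence is
triangular in the length of the word. *)
Lemma quasi_exp_col (o : seq L) :
  quasi_exp (site_poly R [::]) (fun n => col_poly R n o).
Proof.
have [k] := ubnP (size o); elim: k o => // k IH o ok.
apply: (quasi_exp_rec (v := fun n => \sum_(b <- behead (masks (size o)))
  mask_sign R b o *: (col_poly R n (mask (map negb b) o) * site_poly R (mask b o)))).
  move=> n; rewrite /= masks_cons big_cons /=; congr (_ + _).
  have -> : mask_sign R (nseq (size o) false) o = 1 by elim: (o) => //= ? ? ->.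
  have -> : map negb (nseq (size o) false) = nseq (size o) true by rewrite map_nseq.
  by rewrite mask_true // mask_false scale1r mulrC.
apply: quasi_exp_sum => b bm; apply: quasi_expZ.
have tb := behead_masks bm.
have sb : size b = size o by apply: size_masks; apply: mem_behead.
apply: (quasi_exp_ext (u := fun n => site_poly R (mask b o) *
  col_poly R n (mask (map negb b) o))) => [n|]; first by rewrite mulrC.
apply: quasi_expM; apply: IH.
by rewrite (leq_trans (size_mask_lt sb tb)).
Qed.

Variable ker : seq (R * seq L).

(** The part of an averaged row that contains even letters only. *)
Definition row_exponent : Q :=
  \sum_(x <- ker | odds x.2 == [::]) x.1 *: yword R (evens x.2).

(** A row whose odd part is not empty shortens the odd word, so the recurrence is
again triangular. *)
Lemma quasi_exp_row (o : seq L) :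
  quasi_exp row_exponent (fun n => row_poly ker n o).
Proof.
have [k] := ubnP (size o); elim: k o => // k IH o ok.
apply: (quasi_exp_rec (v := fun n => \sum_(x <- ker) if odds x.2 == [::] then 0 else
  x.1 *: (yword R (evens x.2) *
   if prefix (odds x.2) o then row_poly ker n (drop (size (odds x.2)) o) else 0))).
  move=> n; rewrite /= /row_exponent [X in X * _]big_mkcond mulr_suml -big_split /=.
  apply: eq_bigr => x _; case: eqP => [->|_]; last by rewrite mul0r add0r.
  by rewrite prefix0s drop0 addr0 scalerAl.
apply: quasi_exp_sum => x _; have [_|nx] := eqVneq (odds x.2) [::]; first exact: quasi_exp_0.
apply: quasi_expZ; apply: quasi_expM.
case pr: (prefix (odds x.2) o); last exact: quasi_exp_0.
have /prefixP[o' oE] := pr.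
apply: IH; rewrite oE drop_size_cat //.
move: ok; rewrite oE size_cat; case: (odds x.2) nx => //= ? ? _; lia.
Qed.

Variable mom : nat -> R.
Hypothesis ker0 : forall x, x \in ker -> set0 \notin x.2.
Hypothesis ker_row : forall n phi u, alternating phi ->
  row_op K mom n phi u = \sum_(x <- ker) x.1 * word_op n phi x.2 u.

(** Multiples of exponentials from the rows and from the columns multiply to
multiples of one exponential, whose exponent is the sum. *)
Lemma moments_exp_coef : exists (p : Q) (q : {poly Q}), forall n,
  \sum_(i < n.+1) (i`!%:R^-1 * (n - i)`!%:R^-1) *
     iter i (row_op K mom (n - i)) (word_sign R ((n - i) * K)) [::] =
  pairing (exp_coef p q n).
Proof.
exists (row_exponent + site_poly R [::]).
have [q qP] : exists q, forall n, \sum_(o <- short_words K) \sum_(i < n.+1)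
   (i`!%:R^-1 * (n - i)`!%:R^-1 : R) *: (row_poly ker i o * col_poly R (n - i) o) =
   exp_coef (row_exponent + site_poly R [::]) q n.
  elim: (short_words K) => [|o r [q qP]].
    by exists 0 => n; rewrite big_nil exp_coef_0.
  have [q1 q1P] := quasi_exp_row o; have [q2 q2P] := quasi_exp_col o.
  exists (q1 * q2 + q) => n; rewrite big_cons exp_coefD -qP; congr (_ + _).
  rewrite -exp_coefM; apply: eq_bigr => i _.
  by rewrite -q1P -q2P -scalerAl -scalerAr scalerA.
exists q => n; rewrite -qP exchange_big linear_sum /=; apply: eq_bigr => i _.
rewrite (iter_row_pairing ker0 ker_row) mulr_sumr linear_sum /=; apply: eq_bigr => o _.
by rewrite linearZ.
Qed.

End QuasiExpPolys.

(** * Elimination *)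

Lemma linear_dependence (R : fieldType) (A B : finType) (M : A -> B -> R) :
  (#|B| < #|A|)%N ->
  exists2 c : A -> R, exists x, c x != 0 & forall y, \sum_x c x * M x y = 0.
Proof.
move=> lt_BA.
pose N := \matrix_(i < #|A|, j < #|B|) M (enum_val i) (enum_val j).
have : kermx N != 0.
  rewrite -mxrank_eq0 mxrank_ker -lt0n subn_gt0.
  by rewrite (leq_ltn_trans (rank_leq_col N)).
case/matrix0Pn => k [j kj].
exists (fun x => kermx N k (enum_rank x)); first by exists (enum_val j); rewrite enum_valK.
move=> y; have /matrixP/(_ k (enum_rank y)) := mulmx_ker N.
rewrite !mxE => e; rewrite -[RHS]e.
rewrite (reindex (fun i : 'I_#|A| => enum_val i)) /=; last first.
  by apply: onW_bij; apply: enum_val_bij.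
by apply: eq_bigr => i _; rewrite enum_valK; congr (_ * _); rewrite mxE enum_rankK.
Qed.

Section Weyl.
Variables (R : realFieldType) (L : finType).
Local Notation N := #|{: L * bool}|.
Local Notation Q := (mpoly N R).
Implicit Types (i j : L * bool) (g h : Q) (l : Q -> R).

(** The operators that the pairing kills; with multiplication by the variables
they satisfy Weyl's commutation relation. *)
Definition dop i g : Q := var R (dual i) * g - der i g.

Definition xmul i g : Q := var R i * g.

Lemma pairing_dop i g : pairing (dop i g) = 0.
Proof. by rewrite /dop linearB /= pairing_var dualK subrr. Qed.

Lemma dopD i g h : dop i (g + h) = dop i g + dop i h.
Proof. by rewrite /dop mulrDr derD opprD addrACA. Qed.

Lemma dopZ i c g : dop i (c *: g) = c *: dop i g.
Proof. by rewrite /dop derZ -scalerAr scalerBr. Qed.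

Lemma xmul_dop i g : xmul i (dop i g) = dop i (xmul i g) + g.
Proof.
rewrite /xmul /dop derM der_var eqxx mul1r.
ring.
Qed.

Lemma xmul_dopC i j g : i != j -> xmul i (dop j g) = dop j (xmul i g).
Proof.
move=> ij; rewrite /xmul /dop derM der_var eq_sym (negbTE ij) mul0r add0r.
ring.
Qed.

Lemma dopC i j g : dop i (dop j g) = dop j (dop i g).
Proof.
rewrite /dop !derB !derM !der_var (derC i j).
have -> : (i == dual j) = (j == dual i).
  by apply/eqP/eqP => ->; rewrite dualK.
ring.
Qed.

Lemma xmul_iter_dop i b g :
  xmul i (iter b (dop i) g) = iter b (dop i) (xmul i g) + b%:R *: iter b.-1 (dop i) g.
Proof.
elim: b => [|b IH] /=; first by rewrite scale0r addr0.
rewrite xmul_dop IH dopD dopZ -addrA; congr (_ + _).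
case: b {IH} => [|b] /=; first by rewrite scale0r scale1r add0r.
by rewrite -[in RHS]natr1 scalerDl scale1r.
Qed.

Definition xword (s : seq (L * bool)) (a : L * bool -> nat) g :=
  foldr (fun i => iter (a i) (xmul i)) g s.
Definition dword (s : seq (L * bool)) (a : L * bool -> nat) g :=
  foldr (fun i => iter (a i) (dop i)) g s.

Lemma iter_comm (T : Type) (f k : T -> T) b (g : T) : (forall x, f (k x) = k (f x)) ->
  f (iter b k g) = iter b k (f g).
Proof. by move=> fk; elim: b => //= b <-. Qed.

Section Killed.
Variables (l : Q -> R) (i : L * bool).
Hypothesis lD : forall g h, l (g + h) = l g + l h.
Hypothesis lZ : forall c g, l (c *: g) = c * l g.
Hypothesis li : forall g, l (dop i g) = 0.

Lemma iter_xmulD a g h : iter a (xmul i) (g + h) = iter a (xmul i) g + iter a (xmul i) h.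
Proof. by elim: a => //= a ->; rewrite /xmul mulrDr. Qed.

Lemma iter_xmulZ a c g : iter a (xmul i) (c *: g) = c *: iter a (xmul i) g.
Proof. by elim: a => //= a ->; rewrite /xmul -scalerAr. Qed.

Lemma killed_iter_lt a b g : (a < b)%N -> l (iter a (xmul i) (iter b (dop i) g)) = 0.
Proof.
elim: a b g => [|a IH] [|b] g // ab; first exact: li.
by rewrite iterSr xmul_iter_dop iter_xmulD iter_xmulZ lD lZ !IH ?mulr0 ?addr0 // ltnW.
Qed.

Lemma killed_iter_eq a g : l (iter a (xmul i) (iter a (dop i) g)) = a`!%:R * l g.
Proof.
elim: a g => [|a IH] g; first by rewrite mul1r.
rewrite iterSr xmul_iter_dop iter_xmulD iter_xmulZ lD lZ killed_iter_lt // add0r /= IH.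
by rewrite mulrA factS natrM.
Qed.
End Killed.

Lemma iter_dopD i a g h : iter a (dop i) (g + h) = iter a (dop i) g + iter a (dop i) h.
Proof. by elim: a => //= a ->; rewrite dopD. Qed.

Lemma iter_dopZ i a c g : iter a (dop i) (c *: g) = c *: iter a (dop i) g.
Proof. by elim: a => //= a ->; rewrite dopZ. Qed.

Lemma xwordD s a g h : xword s a (g + h) = xword s a g + xword s a h.
Proof. by elim: s => //= i s ->; rewrite iter_xmulD. Qed.

Lemma xwordZ s a c g : xword s a (c *: g) = c *: xword s a g.
Proof. by elim: s => //= i s ->; rewrite iter_xmulZ. Qed.

Lemma xword_iter_dop s i a b g : i \notin s ->
  xword s a (iter b (dop i) g) = iter b (dop i) (xword s a g).
Proof.
elim: s => //= j s IH; rewrite inE negb_or => /andP[ij /IH ->].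
elim: (a j) => //= n ->; apply: iter_comm => x.
by rewrite xmul_dopC // eq_sym.
Qed.

(** By Weyl's relation, [a i] multiplications by the variable [i] remove at most
[a i] of the operators [dop i]; if more of them are there, one is left, and it
is killed. *)
Lemma pairing_xword_dword (l : Q -> R) s a b :
  (forall g h, l (g + h) = l g + l h) -> (forall c g, l (c *: g) = c * l g) ->
  (forall i, i \in s -> forall g, l (dop i g) = 0) -> uniq s ->
  (exists2 i, i \in s & (a i < b i)%N) ->
  forall g, l (xword s a (dword s b g)) = 0.
Proof.
elim: s l => [|i s IH] l lD lZ ls /= => [_ [] //|/andP[ni us] + g].
move=> ab; rewrite xword_iter_dop //.
have li := ls i (mem_head _ _).
have [abi|abi] := ltnP (a i) (b i); first exact: killed_iter_lt.
pose l' h := l (iter (a i) (xmul i) (iter (b i) (dop i) h)).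
rewrite -/(l' _); apply: IH => //.
- by move=> x y; rewrite /l' iter_dopD iter_xmulD lD.
- by move=> c x; rewrite /l' iter_dopZ iter_xmulZ lZ.
- move=> j js x; rewrite /l' -(@iter_comm _ (dop j)); last by move=> ?; apply: dopC.
  rewrite -(@iter_comm _ (dop j)); last first.
    move=> y; rewrite xmul_dopC //.
    by apply: contraNneq ni => ->.
  by rewrite ls // inE js orbT.
- case: ab => j; rewrite inE => /orP[/eqP ->|js jab]; last by exists j.
  by rewrite ltnNge abi.
Qed.

Lemma pairing_xword_dword_eq (l : Q -> R) s a :
  (forall g h, l (g + h) = l g + l h) -> (forall c g, l (c *: g) = c * l g) ->
  (forall i, i \in s -> forall g, l (dop i g) = 0) -> uniq s ->
  forall g, l (xword s a (dword s a g)) = (\prod_(i <- s) (a i)`!)%:R * l g.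
Proof.
move=> lD lZ; elim: s => [|i s IH] ls /= => [_ g|/andP[ni us] g].
  by rewrite big_nil mul1r.
rewrite xword_iter_dop // killed_iter_eq //; last exact: ls (mem_head _ _).
rewrite IH // => [|j js]; last by apply: ls; rewrite inE js orbT.
by rewrite big_cons natrM mulrA.
Qed.

Lemma msize_der i g : (msize (der i g) <= msize g)%N.
Proof.
rewrite msizeE; apply/bigmax_leqP_seq => m; rewrite mcoeff_msupp => mg _.
have := mg; rewrite mcoeff_deriv mulrn_eq0 /= -mcoeff_msupp => /msize_mdeg_lt.
by rewrite mdegD => /(leq_ltn_trans _); apply; rewrite leq_addr.
Qed.

Lemma der_iterX i (p : Q) n : der i (p ^+ n) = n%:R *: (p ^+ n.-1 * der i p).
Proof.
elim: n => [|n IH]; first by rewrite expr0 der1 scale0r.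
rewrite exprS derM IH -scalerAr mulrA -exprS; case: n {IH} => [|n].
  by rewrite !expr0 !scale0r addr0 scale1r mulr1 mul1r.
by rewrite /= -[n.+2%:R]natr1 scalerDl scale1r addrC mulrC.
Qed.

(** ** Degrees of operators on multiples of an exponential *)

Variable p : Q.
Implicit Type q : {poly Q}.

(** All exponents are below [d]: that of the outer variable [t], and those of the
inner variables through their total degree. *)
Definition degree_lt d q := (size q <= d)%N /\ forall k, (msize q`_k <= d)%N.

Lemma degree_ltW d d' q : (d <= d')%N -> degree_lt d q -> degree_lt d' q.
Proof. by move=> dd [sq mq]; split=> [|k]; apply: leq_trans dd. Qed.

Lemma degree_ltD d q r : degree_lt d q -> degree_lt d r -> degree_lt d (q + r).
Proof.
move=> [sq mq] [sr mr]; split=> [|k].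
  by apply: leq_trans (size_polyD _ _) _; rewrite geq_max sq sr.
by rewrite coefD; apply: leq_trans (msizeD_le _ _) _; rewrite geq_max mq mr.
Qed.

Lemma degree_ltC d (c : Q) q : degree_lt d q -> degree_lt (d + (msize c).+1) (c%:P * q).
Proof.
move=> [sq mq]; split=> [|k].
  rewrite mul_polyC; apply: leq_trans (size_scale_leq _ _) _.
  by apply: leq_trans sq _; rewrite leq_addr.
rewrite coefCM; apply: leq_trans (msizeM_le _ _) _.
by rewrite addnS ltnS addnC leq_add2r.
Qed.

Lemma degree_ltX d k q : degree_lt d q -> degree_lt (d + k) ('X^k * q).
Proof.
move=> [sq mq]; split=> [|j].
  apply: leq_trans (size_polyMleq _ _) _; rewrite size_polyXn; lia.
rewrite coefXnM; case: ifP => _; first by rewrite msize0.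
by apply: leq_trans (mq _) _; rewrite leq_addr.
Qed.

(** The degree filtration on the multiples of [exp(p t)]. *)
Definition exp_below d (u : nat -> Q) := exists2 q, degree_lt d q & u =1 exp_coef p q.

Lemma exp_belowW d d' u : (d <= d')%N -> exp_below d u -> exp_below d' u.
Proof. by move=> dd [q qd e]; exists q => //; apply: degree_ltW dd qd. Qed.

Lemma exp_belowD d u v : exp_below d u -> exp_below d v -> exp_below d (fun n => u n + v n).
Proof.
move=> [q qd e] [q' qd' e']; exists (q + q'); first exact: degree_ltD.
by move=> n; rewrite exp_coefD e e'.
Qed.

Lemma exp_belowZ d (c : R) u : exp_below d u -> exp_below d (fun n => c *: u n).
Proof.
move=> [q [sq mq] e]; exists (c%:A%:P * q); last first.
  by move=> n; rewrite exp_coefC e -scalerAl mul1r.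
split=> [|k].
  by rewrite mul_polyC; apply: leq_trans (size_scale_leq _ _) _.
by rewrite coefCM -scalerAl mul1r; apply: leq_trans (msizeZ_le _ _) _.
Qed.

(** A bound for the growth of the degree under each of the operators below. *)
Definition op_cost := (msize p + 3)%N.

Lemma exp_below_nat d u : exp_below d u ->
  exp_below (d + op_cost) (fun n => n%:R *: u n).
Proof.
move=> [q qd e]; exists ('X^1 * (q^`() + p%:P * q)).
  apply: (@degree_ltW (d + (msize p).+1 + 1)); first by rewrite /op_cost; lia.
  apply: degree_ltX; apply: degree_ltD; last exact: degree_ltC.
  apply: (@degree_ltW d); first by rewrite leq_addr.
  case: qd => sq mq; split=> [|k].
    apply: leq_trans sq; apply/leq_sizeP => j jq.
    by rewrite coef_deriv nth_default ?mul0rn //; apply: leqW.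
  by rewrite coef_deriv -scaler_nat; apply: leq_trans (msizeZ_le _ _) _.
move=> n; rewrite e exp_coefXn; case: n => [|n]; first by rewrite scale0r.
by rewrite exp_coefS subn1 /= exp_coefD exp_coefC addrC.
Qed.

Lemma der_exp_coef i q n :
  der i (exp_coef p q n) =
    exp_coef p (map_poly (der i) q + 'X^1 * ((der i p)%:P * q)) n.
Proof.
rewrite exp_coefD exp_coefXn; case: n => [|n].
  by rewrite !exp_coef0 addr0 coef_map_id0 // der0.
rewrite subn1 /= exp_coefC /exp_coef der_sum.
under eq_bigr do rewrite derZ derM der_iterX scalerDr.
rewrite big_split /=; congr (_ + _).
  by apply: eq_bigr => j _; rewrite coef_map_id0 ?der0.
rewrite big_ord_recr /= subnn scale0r mulr0 scaler0 addr0 mulr_sumr.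
apply: eq_bigr => j _; rewrite subSn ?(ltnSE (ltn_ord j)) //=.
rewrite -!scalerAr !scalerA [_^-1 * _]mulrC factS_inv; congr (_ *: _).
by rewrite mulrA mulrC.
Qed.

Lemma exp_below_dop i d u : exp_below d u ->
  exp_below (d + op_cost) (fun n => dop i (u n)).
Proof.
move=> [q qd e].
exists ((var R (dual i))%:P * q + (-1)%:A%:P *
   (map_poly (der i) q + 'X^1 * ((der i p)%:P * q))); last first.
  move=> n; rewrite exp_coefD !exp_coefC -der_exp_coef e /dop.
  by rewrite scaleN1r mulN1r.
apply: degree_ltD.
  apply: degree_ltW (degree_ltC _ qd); rewrite /var msizeX mdeg1 /op_cost; lia.
have [sq mq] := qd.
have H : degree_lt (d + op_cost) (map_poly (der i) q + 'X^1 * ((der i p)%:P * q)).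
  apply: degree_ltD.
    apply: (@degree_ltW d); first by rewrite leq_addr.
    split=> [|k]; first by apply: leq_trans (size_poly _ _) _.
    by rewrite coef_map_id0 ?der0 //; apply: leq_trans (msize_der _ _) _.
  apply: (@degree_ltW (d + (msize (der i p)).+1 + 1)).
    by have := msize_der i p; rewrite /op_cost; lia.
  by apply: degree_ltX; apply: degree_ltC.
case: H => sH mH; split=> [|k].
  by rewrite mul_polyC; apply: leq_trans (size_scale_leq _ _) _.
by rewrite coefCM -scalerAl mul1r; apply: leq_trans (msizeZ_le _ _) _.
Qed.

Lemma exp_below_shift k d u : exp_below d u ->
  exp_below (d + k) (fun n => if (k <= n)%N then u (n - k)%N else 0).
Proof.
move=> [q qd e]; exists ('X^k * q); first exact: degree_ltX.
by move=> n; rewrite exp_coefXn; case: ifP => // _; rewrite e.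
Qed.

(** A polynomial in [n] whose value at [n = 2 m] is the falling factorial of [m]
of order [b]. *)
Definition half_ffact b (n : nat) : R := \prod_(j < b) (n%:R / 2 - j%:R).

Lemma half_ffactE b n : half_ffact b (n + n) = (n ^_ b)%:R.
Proof.
have e : (n + n)%:R / 2 = n%:R :> R by rewrite natrD; field.
rewrite /half_ffact e; elim: b => [|b IH]; first by rewrite big_ord0 ffactn0.
rewrite big_ord_recr /= IH ffactnSr natrM.
have [bn|nb] := leqP b n; first by rewrite natrB.
by rewrite ffact_small // !mul0r.
Qed.

Lemma exp_below_half_ffact b d u : exp_below d u ->
  exp_below (d + b * op_cost) (fun n => half_ffact b n *: u n).
Proof.
move=> du; elim: b => [|b IH].
  rewrite addn0; case: du => q qd e; exists q => // n.
  by rewrite /half_ffact big_ord0 scale1r.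
have := exp_belowD (exp_below_nat (exp_belowZ 2^-1 IH))
  (exp_belowW (leq_addr op_cost _) (exp_belowZ (- b%:R) IH)).
rewrite mulSnr addnA => -[q qd e]; exists q => // n.
rewrite -e /half_ffact big_ord_recr /= !scalerA -scalerDl; congr (_ *: _).
by rewrite mulrBr; ring.
Qed.

Lemma exp_below_dword s a d u : exp_below d u ->
  exp_below (d + (\sum_(i <- s) a i) * op_cost) (fun n => dword s a (u n)).
Proof.
move=> du; elim: s => [|i s IH]; first by rewrite big_nil addn0.
have -> : (d + (\sum_(j <- i :: s) a j) * op_cost =
    d + (\sum_(j <- s) a j) * op_cost + a i * op_cost)%N.
  by rewrite big_cons mulnDl; lia.
suff E b : exp_below (d + (\sum_(j <- s) a j) * op_cost + b * op_cost)
    (fun n => iter b (dop i) (dword s a (u n))) by exact: E (a i).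
elim: b => [|b IHb]; first by rewrite mul0n addn0.
by rewrite mulSnr addnA; apply: exp_below_dop.
Qed.

(** ** The counting argument *)

Let V v := ('I_v * 'I_v * {ffun L * bool -> 'I_v})%type.

Definition exponent v (x : V v) (i : L * bool) : nat := x.2 i.

(** With [s = t ^ 2], the operator [s ^ (a + b) (d/ds) ^ b] after a word in the
operators [dop]; [a], [b] and the exponents of the word are the components
of [x]. *)
Definition weyl_op v (x : V v) (u : nat -> Q) (n : nat) : Q :=
  if (x.1.1.*2 <= n)%N then
    half_ffact x.1.2 (n - x.1.1.*2) *:
      dword (enum {: L * bool}) (exponent x) (u (n - x.1.1.*2)%N)
  else 0.

Lemma exp_below_weyl_op v (x : V v) d u : exp_below d u ->
  exp_below (d + v * (2 + op_cost + #|{: L * bool}| * op_cost)) (weyl_op x u).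
Proof.
move=> du.
have H := exp_below_shift x.1.1.*2 (exp_below_half_ffact x.1.2
  (exp_below_dword (enum {: L * bool}) (exponent x) du)).
have [q qd e] := H; exists q => //.
apply: degree_ltW qd.
have h1 := ltn_ord x.1.1; have h2 := ltn_ord x.1.2.
have h3 : (\sum_(i <- enum {: L * bool}) exponent x i <= v * #|{: L * bool}|)%N.
  rewrite big_enum /= -sum1_card big_distrr /=.
  by apply: leq_sum => i _; rewrite muln1; apply: ltnW; apply: ltn_ord.
have aux s o n a b : (a < v -> b < v -> s <= v * n ->
    d + s * o + b * o + a.*2 <= d + v * (2 + o + n * o))%N.
  by clear; move=> *; nia.
exact: aux.
Qed.

(** More operators than dimensions: a nontrivial combination of the operators
annihilates a given multiple of the exponential. *)
Lemma weyl_annihilator d u : exp_below d u -> exists v (c : V v -> R),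
  (exists x, c x != 0) /\ forall n, \sum_x c x *: weyl_op x u n = 0.
Proof.
move=> du.
(* the degree after operators of exponents below [v] is at most [C * v] *)
pose C := (d + (2 + op_cost + #|{: L * bool}| * op_cost)).+1%N.
pose v := (C ^ (#|{: L * bool}|.+1)).+1%N.
have du' (x : V v) : exists q, degree_lt (C * v) q /\ weyl_op x u =1 exp_coef p q.
  have [|q qd e] := @exp_belowW _ (C * v) _ _ (exp_below_weyl_op x du); last by exists q.
  have aux s : (d + v * s <= (d + s).+1 * v)%N.
    have : (0 < v)%N by [].
    by move: (v) => w; clear; move=> *; nia.
  exact: aux.
have [F FP] := fin_all_exists du'.
pose D := (C * v)%N.
pose mon (m : {ffun 'I_N -> 'I_D}) : multinom N :=
  Multinom [tuple (m i : nat) | i < N].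
have [|c [x cx] cP] := @linear_dependence R (V v) ('I_D * {ffun 'I_N -> 'I_D})%type
  (fun x y => mcoeff (mon y.2) (F x)`_y.1).
  rewrite !card_prod !card_ffun !card_ord /D -expnS -mulnA -!expnS expnMn.
  rewrite [(v ^ _.+2)%N]expnS !card_prod ltn_pmul2r ?expn_gt0 // /v !card_prod.
  exact: ltnSn.
exists v, c; split; first by exists x.
move=> n.
transitivity (exp_coef p (\sum_x (c x)%:A%:P * F x) n).
  rewrite exp_coef_sum; apply: eq_bigr => y _.
  by rewrite exp_coefC -(proj2 (FP y)) -scalerAl mul1r.
suff -> : \sum_x (c x)%:A%:P * F x = 0 by rewrite exp_coef_0.
apply/polyP => k; rewrite coef0 coef_sum; apply/mpolyP => m.
rewrite mcoeff0 linear_sum /=.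
under eq_bigr do rewrite coefCM -scalerAl mul1r mcoeffZ.
have [kD|Dk] := ltnP k D; last first.
  apply: big1 => y _; have [[sy _] _] := FP y.
  by rewrite nth_default ?mcoeff0 ?mulr0 // (leq_trans sy).
have [mD|/forallPn[i mi]] := boolP [forall i, m i < D]%N; last first.
  apply: big1 => y _; have [[_ my] _] := FP y.
  rewrite memN_msupp_eq0 ?mulr0 //; apply: msize_mdeg_ge.
  apply: leq_trans (my k) _; rewrite -leqNgt in mi; apply: leq_trans mi _.
  by rewrite mdegE (bigD1 i) //= leq_addr.
rewrite -[RHS](cP (Ordinal kD, [ffun i => Ordinal (forallP mD i)])) /=.
apply: eq_bigr => y _; congr (_ * mcoeff _ _).
by apply/mnmP => i; rewrite mnmE ffunE.
Qed.

(** Pairing the annihilating combination with the right monomial leaves an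
operator in [s] and [d/ds] alone. *)
Lemma pairing_annihilator d u : exp_below d u -> exists v (c : 'I_v -> 'I_v -> R),
  (exists a b, c a b != 0) /\ forall n, \sum_a \sum_b c a b *
    (if (a <= n)%N then ((n - a) ^_ b)%:R * pairing (u (n - a + (n - a)))%N else 0) = 0.
Proof.
move=> /weyl_annihilator[v [c [[x0 cx0] cP]]].
pose deg (x : V v) := (\sum_i exponent x i)%N.
(* at an exponent of least total degree, every other exponent in the
   combination exceeds it somewhere, and its term is killed *)
have [x cx xmin] := @arg_minnP (V v) x0 (fun x => c x != 0) deg cx0.
exists v, (fun a b => c (a, b, x.2)); split.
  by exists x.1.1, x.1.2; rewrite -surjective_pairing -surjective_pairing.
move=> n.
pose s := enum {: L * bool}.
have us : uniq s := enum_uniq _.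
pose l g := pairing (xword s (exponent x) g).
have lD g h : l (g + h) = l g + l h by rewrite /l xwordD linearD.
have lZ a g : l (a *: g) = a * l g by rewrite /l xwordZ linearZ.
have l0 : l 0 = 0 by have := lZ 0 0; rewrite scale0r mul0r.
pose F := \prod_(i <- s) (exponent x i)`!.
pose T a b := if (a <= n)%N
  then ((n - a) ^_ b)%:R * pairing (u (n - a + (n - a)))%N else 0.
have cT y : l (c y *: weyl_op y u (n + n)) =
    if y.2 == x.2 then F%:R * (c y * T y.1.1 y.1.2) else 0.
  rewrite lZ; have [->|cy] := eqVneq (c y) 0; first by rewrite !mul0r mulr0 if_same.
  rewrite /weyl_op /T addnn leq_double; case: leqP => _; last by rewrite l0 !mulr0 if_same.
  rewrite -doubleB -addnn lZ half_ffactE.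
  have [e|ne] := eqVneq y.2 x.2.
    have -> : exponent y = exponent x by rewrite /exponent e.
    rewrite /l (pairing_xword_dword_eq (l := @pairing R L)) //.
    - by rewrite -/F; ring.
    - by move=> g h; rewrite linearD.
    - by move=> a g; rewrite linearZ.
    - by move=> i _ g; apply: pairing_dop.
  rewrite /l (pairing_xword_dword (l := @pairing R L)) ?mulr0 //.
  - by move=> g h; rewrite linearD.
  - by move=> a g; rewrite linearZ.
  - by move=> i _ g; apply: pairing_dop.
  apply/exists_inP; apply: contraT; rewrite negb_exists_in => /forall_inP H.
  have le i : (exponent y i <= exponent x i)%N.
    by rewrite leqNgt H // mem_enum.
  case/eqP: ne; apply/ffunP => i; apply/val_inj/eqP; rewrite /= eqn_leq le /=.
  have := xmin y cy; rewrite /deg (bigD1 i) //= [X in (_ <= X)%N](bigD1 i) //=.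
  have : (\sum_(j | j != i) exponent y j <= \sum_(j | j != i) exponent x j)%N.
    by apply: leq_sum => j _; apply: le.
  by rewrite /exponent; move: (\sum_(j | _) _)%N (\sum_(j | _) _)%N => A B; lia.
have := congr1 l (cP (n + n)%N); rewrite l0 (big_morph l lD l0).
under eq_bigr do rewrite cT.
rewrite -big_mkcond -mulr_sumr => /eqP; rewrite mulf_eq0 pnatr_eq0.
rewrite [F == 0%N]negbTE ?orFb; last first.
  by rewrite -lt0n prodn_gt0 // => i; rewrite fact_gt0.
move/eqP => e; rewrite -[RHS]e pair_bigA /=.
rewrite (reindex_onto (fun ab : 'I_v * 'I_v => (ab, x.2)) fst) /=; last first.
  by move=> [ab al] /= /eqP ->.
by apply: eq_big => [[a b]|[a b] _] //=; rewrite !eqxx.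
Qed.

Lemma exp_below_exp_coef q : exists d, exp_below d (exp_coef p q).
Proof.
pose d := (size q + \max_(k < size q) msize q`_k)%N.
exists d; exists q => //; split=> [|k]; first exact: leq_addr.
have [ks|sk] := ltnP k (size q); last by rewrite nth_default // msize0.
apply: leq_trans (leq_addl _ _).
exact: (leq_bigmax (F := fun k : 'I_(size q) => msize q`_k) (Ordinal ks)).
Qed.

End Weyl.

Lemma iter_fps_deriv (R : nzRingType) (F : nat -> R) i n :
  iter i (@fps_deriv R) F n = ((n + i) ^_ i)%:R * F (n + i)%N.
Proof.
elim: i n => [|i IH] n; first by rewrite addn0 ffactn0 mul1r.
rewrite iterS /fps_deriv IH mulrA -natrM addSnnS; congr (_%:R * _).
by rewrite [(_ ^_ i.+1)%N]ffactnSr mulnC; congr (_ * _)%N; lia.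
Qed.

(** On the coefficient of [s ^ n], the operator [s ^ b (d/ds) ^ b] is
multiplication by the falling factorial of [n] of order [b]. *)
Lemma D_finite_euler (R : fieldType) (F : nat -> R) v (c : 'I_v -> 'I_v -> R) :
  (exists a b, c a b != 0) ->
  (forall n, \sum_a \sum_b c a b *
    (if (a <= n)%N then ((n - a) ^_ b)%:R * F (n - a)%N else 0) = 0) ->
  D_finite F.
Proof.
case: v c => [|v] c [a0 [b0 cab]] H; first by case: a0 {cab}.
exists v, (fun b => \sum_a c a b *: 'X^(a + b)); split.
  exists b0; apply: contraNneq cab => /(congr1 (fun q : {poly R} => q`_(a0 + b0))).
  rewrite coef0 coef_sum (bigD1 a0) //= big1 => [|a na].
    by rewrite coefZ coefXn eqxx mulr1 addr0 => ->.
  by rewrite coefZ coefXn eqn_add2r eq_sym (inj_eq val_inj) (negbTE na) mulr0.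
move=> n; rewrite -[RHS](H n) [RHS]exchange_big /=; apply: eq_bigr => b _.
transitivity (\sum_(k < n.+1) \sum_(a < v.+1)
    (c a b *: 'X^(a + b) : {poly R})`_k * iter b (@fps_deriv R) F (n - k)%N).
  by apply: eq_bigr => k _; rewrite -mulr_suml; congr (_ * _); exact: coef_sum.
rewrite exchange_big /=; apply: eq_bigr => a _.
under eq_bigr do rewrite coefZ coefXn iter_fps_deriv -mulrA.
rewrite -mulr_sumr; congr (_ * _).
have [ab|ab] := leqP (a + b) n.
  rewrite (bigD1 (Ordinal (ab : (a + b < n.+1)%N))) //= eqxx mul1r big1.
    rewrite addr0 (leq_trans (leq_addr b a) ab).
    by have -> : (n - (a + b) + b = n - a)%N by lia.
  by move=> k; rewrite -val_eqE /= => /negbTE ->; rewrite mul0r.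
rewrite big1 => [|k _].
  case: leqP => // an; rewrite ffact_small ?mul0r //; lia.
case: eqP => [e|_]; last by rewrite mul0r.
by have := ltn_ord k; rewrite e ltnS leqNgt ab.
Qed.

Theorem pairing_exp_D_finite (R : realFieldType) (L : finType)
    (p : mpoly #|{: L * bool}| R) (q : {poly mpoly #|{: L * bool}| R}) (F : nat -> R) :
  (forall n, F n = pairing (exp_coef p q (n + n))) -> D_finite F.
Proof.
move=> FE; have [d du] := exp_below_exp_coef p q.
have [v [c [c0 cP]]] := pairing_annihilator du.
apply: (D_finite_euler c0) => n; rewrite -[RHS](cP n).
by apply: eq_bigr => a _; apply: eq_bigr => b _; rewrite FE.
Qed.

From mathcomp Require Import all_classical all_reals all_analysis.
From mathcomp Require Import measurable_realfun.
Import Order.TTheory GRing.Theory Num.Theory.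
Import numFieldNormedType.Exports.

Local Open Scope classical_set_scope.
Local Open Scope ring_scope.

(** * Expectations of products of independent variables *)

Section ProductExpectation.
Context {R : realType} {d : measure_display} {T : measurableType d}.
Variable P : probability T R.

Section OneVariable.
Variables (X : T -> R) (mX : measurable_fun setT X).

Import HBNNSimple.

Section Approximation.
Variables (f : R -> R) (mf : measurable_fun setT f) (f0 : forall x, 0 <= f x).
Variables (H : T -> R) (mH : measurable_fun setT H) (H0 : forall w, 0 <= H w).

Let mEf : measurable_fun [set: R] (fun x : R => (f x)%:E).
Proof. exact/measurable_EFinP. Qed.

Let f_ := nnsfun_approx measurableT mEf.

Let level (n : nat) (k : R) : set R := f_ n @^-1` [set k].

Let mlevel n k : measurable (level n k).
Proof. exact: measurable_sfunP. Qed.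

Let f_lim (x : R) : (fun n => f_ n x) @ \oo --> f x.
Proof.
have := @cvg_nnsfun_approx _ _ _ _ measurableT _ mEf _ x.
by move/(_ (fun y _ => f0 y)) => /(_ I) /fine_cvgP[_].
Qed.

(** Simple functions approximate [f], so its integral only involves the weight
[H] on events of [X]. *)
Lemma integral_simple_approx : (\int[P]_w (f (X w) * H w)%:E =
  limn (fun n => \sum_(k \in range (f_ n))
     (k%:E * \int[P]_w (\1_(level n k) (X w) * H w)%:E)))%E.
Proof.
transitivity (limn (fun n => \int[P]_w (f_ n (X w) * H w)%:E))%E.
  rewrite -monotone_convergence //.
  - apply: eq_integral => w _; apply/esym/cvg_lim => //.
    apply: cvg_EFin; first by near=> n.
    by apply: cvgM; [exact: f_lim | exact: cvg_cst].
  - move=> n; apply/measurable_EFinP; apply: measurable_funM => //.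
    by apply: measurableT_comp => //; exact: measurable_funP.
  - by move=> n w _; rewrite lee_fin mulr_ge0.
  - move=> w _ m n mn; rewrite lee_fin ler_wpM2r //.
    exact/lefP/nd_nnsfun_approx.
congr (limn _); apply/funext => n.
have mterm k : measurable_fun [set: T] (fun w => \1_(level n k) (X w) * H w).
  apply: measurable_funM => //.
  by apply: measurableT_comp => //; exact: measurable_indic.
have term0 k w : 0 <= k * (\1_(level n k) (X w) * H w).
  have [k0|k0] := leP 0 k; first by rewrite !mulr_ge0.
  by rewrite /level preimage_nnfun0 // indic0 mul0r mulr0.
transitivity (\int[P]_w (\sum_(k \in range (f_ n))
    (k * (\1_(level n k) (X w) * H w))%:E))%E.
  apply: eq_integral => w _; rewrite fsumEFin //; congr EFin.
  rewrite {1}(fimfunE (f_ n)) mulr_fsuml.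
  by apply: eq_fsbigr => k _; rewrite mulrA.
rewrite ge0_integral_fsum //; last 2 first.
- by move=> k; apply/measurable_EFinP; apply: measurable_funM.
- by move=> k w _; rewrite lee_fin.
apply: eq_fsbigr => k _.
have [k0|k0] := leP 0 k.
  under eq_integral do rewrite EFinM.
  rewrite ge0_integralZl_EFin //; last exact/measurable_EFinP.
  by move=> w _; rewrite lee_fin mulr_ge0.
under eq_integral do rewrite /level preimage_nnfun0 // indic0 mul0r mulr0.
rewrite integral0; under eq_integral do rewrite /level preimage_nnfun0 // indic0 mul0r.
by rewrite integral0 mule0.
Unshelve. all: by end_near.
Qed.
End Approximation.

(** Both sides are the same limit of combinations of integrals over events of [X]. *)
Lemma eq_integral_weight (H1 H2 : T -> R) :
  measurable_fun setT H1 -> measurable_fun setT H2 ->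
  (forall w, 0 <= H1 w) -> (forall w, 0 <= H2 w) ->
  (forall B, measurable B -> (\int[P]_w (\1_B (X w) * H1 w)%:E =
     \int[P]_w (\1_B (X w) * H2 w)%:E)%E) ->
  forall f : R -> R, measurable_fun setT f -> (forall x, 0 <= f x) ->
  (\int[P]_w (f (X w) * H1 w)%:E = \int[P]_w (f (X w) * H2 w)%:E)%E.
Proof.
move=> mH1 mH2 H10 H20 E f mf f0.
rewrite !(integral_simple_approx mf) //; congr (limn _); apply/funext => n.
by apply: eq_fsbigr => k _; rewrite E //; exact: measurable_sfunP.
Qed.
End OneVariable.

Variables (I : finType) (X : I -> {RV P >-> R}).
Hypothesis Xind : mutually_independent X.
Implicit Types (g : I -> R -> R) (e : I -> R).

Let mX i : measurable_fun [set: T] (X i).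
Proof. exact: measurable_funP. Qed.

Let mgX g i : measurable_fun setT (g i) -> measurable_fun [set: T] (fun w => g i (X i w)).
Proof. by move=> mg; apply: measurableT_comp. Qed.

Let mprodX g (Q : pred I) : (forall i, measurable_fun setT (g i)) ->
  measurable_fun [set: T] (fun w => \prod_(i | Q i) g i (X i w)).
Proof.
move=> mg; under eq_fun do rewrite big_mkcond.
apply: (@measurable_prod _ _ _ _ _ _ (fun i w => if Q i then g i (X i w) else 1)) => i _.
by case: (Q i) => //; exact: mgX.
Qed.

Lemma integral_prod_indic (B : I -> set R) : (forall i, measurable (B i)) ->
  (\int[P]_w (\prod_i \1_(B i) (X i w))%:E =
   \prod_i \int[P]_w (\1_(B i) (X i w))%:E)%E.
Proof.
move=> mB.
have mXB i : measurable (X i @^-1` B i) by rewrite -[_ @^-1` _]setTI; apply: mX.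
have intB i : (\int[P]_w (\1_(B i) (X i w))%:E = P (X i @^-1` B i))%E.
  by rewrite -[in RHS](setIT (X i @^-1` B i)) -integral_indic.
under [RHS]eq_bigr do rewrite intB.
have := Xind (finset.setTfor I) mB.
have <- : (\prod_(i in finset.setTfor I) P (X i @^-1` B i) =
    \prod_i P (X i @^-1` B i))%E.
  by apply: eq_bigl => i; rewrite finset.in_setT.
move=> <-; set C := \bigcap_(i in _) _.
have mC : measurable C by apply: fin_bigcap_measurable => // i _.
rewrite -[in RHS](setIT C) -integral_indic //; apply: eq_integral => w _; congr EFin.
rewrite indicE; case: (boolP (w \in C)) => [/set_mem Cw|/negP nC].
  rewrite big1 // => i _; rewrite indicE mem_set //.
  by apply: Cw => /=; rewrite inE.
apply/eqP; rewrite prodf_seq_eq0; apply/hasP.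
have [i] : exists i, ~ B i (X i w).
  by apply/existsNP => H; apply: nC; apply/mem_set => i _; apply: H.
by exists i; rewrite ?mem_index_enum //= indicE memNset.
Qed.

(** Independence is the case of indicators; the factors are freed from being
indicators one at a time. *)
Lemma integral_prod_ge0 g e :
  (forall i, measurable_fun setT (g i)) -> (forall i x, 0 <= g i x) ->
  (forall i, \int[P]_w (g i (X i w))%:E = (e i)%:E)%E ->
  (\int[P]_w (\prod_i g i (X i w))%:E = (\prod_i e i)%:E)%E.
Proof.
suff H (zs : seq I) : forall g e,
  (forall i, measurable_fun setT (g i)) -> (forall i x, 0 <= g i x) ->
  (forall i, \int[P]_w (g i (X i w))%:E = (e i)%:E)%E ->
  (forall i, i \notin zs -> exists2 B, measurable B & g i = \1_B) ->
  (\int[P]_w (\prod_i g i (X i w))%:E = (\prod_i e i)%:E)%E.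
  by move=> mg g0 ge; apply: (H (enum I)) => // i; rewrite mem_enum.
elim: zs => [|i zs IH] {}g {}e mg g0 ge gB.
  have {}gB i : {B | measurable B & g i = \1_B}.
    by apply: cid2; apply: gB.
  pose B i := s2val (gB i).
  have gBE i : g i = \1_(B i) by rewrite /B; case: (gB i).
  have mB i : measurable (B i) by rewrite /B; case: (gB i).
  under eq_integral do under eq_bigr do rewrite gBE.
  rewrite integral_prod_indic // -prodEFin; apply: eq_bigr => i _.
  by rewrite -ge gBE.
pose H1 w := \prod_(j | j != i) g j (X j w).
pose H2 (w : T) : R := \prod_(j | j != i) e j.
have e0 j : 0 <= e j.
  by rewrite -lee_fin -ge; apply: integral_ge0 => w _; rewrite lee_fin.
have mH1 : measurable_fun [set: T] H1 by exact: mprodX.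
have mH2 : measurable_fun [set: T] H2 by exact: measurable_cst.
have H10 w : 0 <= H1 w by apply: prodr_ge0 => j _.
have H20 w : 0 <= H2 w by apply: prodr_ge0 => j _.
transitivity (\int[P]_w (g i (X i w) * H1 w)%:E)%E.
  by apply: eq_integral => w _; rewrite (bigD1 i).
rewrite (eq_integral_weight (mX i) mH1 mH2) //; last first.
  move=> B mB; pose g' j := if j == i then \1_B else g j.
  have mXB : measurable (X i @^-1` B) by rewrite -[_ @^-1` _]setTI; apply: mX.
  pose e' j := if j == i then fine (P (X i @^-1` B)) else e j.
  transitivity (\int[P]_w (\prod_j g' j (X j w))%:E)%E.
    apply: eq_integral => w _; rewrite (bigD1 i) //= /g' eqxx; congr (_ * _)%:E.
    by apply: eq_bigr => j /negbTE ->.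
  have intB : (\int[P]_w (\1_B (X i w))%:E = P (X i @^-1` B))%E.
    by rewrite -[in RHS](setIT (X i @^-1` B)) -integral_indic.
  rewrite (IH g' e').
  - rewrite (bigD1 i) //= /e' eqxx.
    under [RHS]eq_integral do rewrite /H2 mulrC EFinM.
    rewrite ge0_integralZl_EFin ?prodr_ge0 //; last first.
      by apply/measurable_EFinP; apply: measurableT_comp => //; exact: measurable_indic.
    rewrite intB -[P _]fineK ?fin_num_measure // -EFinM mulrC; congr (_ * _)%:E.
    by apply: eq_bigr => j /negbTE ->.
  - by move=> j; rewrite /g'; case: eqP => // _; exact: measurable_indic.
  - by move=> j x; rewrite /g'; case: eqP.
  - move=> j; rewrite /g' /e'; case: eqP => // ->.
    by rewrite intB fineK ?fin_num_measure.
  - move=> j jzs; rewrite /g'; case: eqP => [_|/eqP ji]; first by exists B.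
    by apply: gB; rewrite inE negb_or ji.
under eq_integral do rewrite /H2 mulrC EFinM.
rewrite ge0_integralZl_EFin ?prodr_ge0 //; last first.
- by apply/measurable_EFinP; exact: mgX.
- by move=> w _; rewrite lee_fin.
by rewrite ge -EFinM mulrC [in RHS](bigD1 i).
Qed.

Lemma integrable_EFinP (h : T -> R) (c : R) : measurable_fun [set: T] h ->
  (forall w, 0 <= h w) -> (\int[P]_w (h w)%:E = c%:E)%E ->
  P.-integrable setT (EFin \o h).
Proof.
move=> mh h0 hc; apply/integrableP; split; first exact/measurable_EFinP.
under eq_integral do rewrite /= ger0_norm //.
by rewrite hc ltry.
Qed.

(** Signed factors are reached from nonnegative ones by splitting one factor at a
time into its positive and negative parts. *)
Lemma integral_prod g e :
  (forall i, measurable_fun setT (g i)) ->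
  (forall i, P.-integrable setT (fun w => (g i (X i w))%:E)) ->
  (forall i, \int[P]_w (g i (X i w))%:E = (e i)%:E)%E ->
  P.-integrable setT (fun w => (\prod_i g i (X i w))%:E) /\
  (\int[P]_w (\prod_i g i (X i w))%:E = (\prod_i e i)%:E)%E.
Proof.
suff H (zs : seq I) : forall g e,
  (forall i, measurable_fun setT (g i)) ->
  (forall i, P.-integrable setT (fun w => (g i (X i w))%:E)) ->
  (forall i, \int[P]_w (g i (X i w))%:E = (e i)%:E)%E ->
  (forall i, i \notin zs -> forall x, 0 <= g i x) ->
  P.-integrable setT (fun w => (\prod_i g i (X i w))%:E) /\
  (\int[P]_w (\prod_i g i (X i w))%:E = (\prod_i e i)%:E)%E.
  by move=> mg ig ge; apply: (H (enum I)) => // i; rewrite mem_enum.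
elim: zs => [|i zs IH] {}g {}e mg ig ge g0.
  have eq := integral_prod_ge0 mg (fun i => g0 i isT) ge; split=> //.
  apply: integrable_EFinP eq; first exact: mprodX.
  by move=> w; apply: prodr_ge0 => j _; apply: g0.
pose gs (s : R) (j : I) (x : R) := if j == i then Num.max (s * g i x) 0 else g j x.
have mgs s j : measurable_fun setT (gs s j).
  rewrite /gs; case: eqP => // _.
  by apply: measurable_maxr => //; apply: measurable_funM.
have igs s j : `|s| = 1 -> P.-integrable setT (fun w => (gs s j (X j w))%:E).
  move=> s1; apply: (le_integrable measurableT _ _ (ig j)).
    by apply/measurable_EFinP; apply: (mgX (g := gs s)).
  move=> w _; rewrite lee_fin /gs; case: eqP => [->|_] //.
  rewrite ger0_norm ?le_max ?lexx ?orbT //.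
  by rewrite ge_max normr_ge0 andbT -[leRHS]mul1r -s1 -normrM ler_norm.
pose es s j := fine (\int[P]_w (gs s j (X j w))%:E)%E.
have ges s j : `|s| = 1 -> (\int[P]_w (gs s j (X j w))%:E = (es s j)%:E)%E.
  by move=> s1; rewrite fineK // integral_fune_fin_num //; apply: igs.
have IHs s : `|s| = 1 -> P.-integrable setT (fun w => (\prod_j gs s j (X j w))%:E) /\
  (\int[P]_w (\prod_j gs s j (X j w))%:E = (\prod_j es s j)%:E)%E.
  move=> s1; apply: IH => //.
  - by move=> j; apply: igs.
  - by move=> j; apply: ges.
  - move=> j jzs x; rewrite /gs; case: eqP => [_|/eqP ji].
      by rewrite le_max lexx orbT.
    by apply: g0; rewrite inE negb_or ji.
have [|ip ep] := IHs 1; first exact: normr1.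
have [|im em] := IHs (-1); first by rewrite normrN1.
have gE x : g i x = gs 1 i x - gs (-1) i x.
  rewrite /gs eqxx mul1r mulN1r; case/orP: (le_total 0 (g i x)) => g0x.
    by rewrite max_l // max_r ?subr0 // oppr_le0.
  by rewrite max_r // max_l ?oppr_ge0 // sub0r opprK.
have gsE s j x : j != i -> gs s j x = g j x by rewrite /gs => /negbTE ->.
have prodE : (fun w => (\prod_j g j (X j w))%:E) =
    (fun w => (\prod_j gs 1 j (X j w))%:E - (\prod_j gs (-1) j (X j w))%:E)%E.
  apply/funext => w; rewrite -EFinB; congr EFin.
  rewrite (bigD1 i) //= [X in _ = X - _](bigD1 i) //= [X in _ = _ - X](bigD1 i) //=.
  rewrite gE mulrBl; congr (_ * _ - _ * _); apply: eq_bigr => j ji; rewrite gsE //.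
have iB : P.-integrable setT (fun w => (\prod_j g j (X j w))%:E).
  by rewrite prodE; apply: integrableB.
split=> //; rewrite prodE integralB_EFin // ep em -EFinB; congr EFin.
rewrite (bigD1 i) //= [X in _ - X = _](bigD1 i) //= [RHS](bigD1 i) //=.
have esE s j : `|s| = 1 -> j != i -> es s j = e j.
  move=> s1 ji; apply: EFin_inj; rewrite -ges // -ge.
  by apply: eq_integral => w _; rewrite gsE.
have -> : e i = es 1 i - es (-1) i.
  apply: EFin_inj; rewrite -ge EFinB -!ges ?normr1 ?normrN1 // -integralB_EFin //.
  - by apply: eq_integral => w _; rewrite gE.
  - by apply: igs; rewrite normr1.
  - by apply: igs; rewrite normrN1.
rewrite mulrBl; congr (_ * _ - _ * _); apply: eq_bigr => j ji; rewrite esE ?normr1 ?normrN1 //.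
Qed.

End ProductExpectation.

(** * The determinant *)

Section Moments.
Variables (R : realType) (law : probability R R).

Definition moment (r : nat) : R := fine (\int[law]_x (x ^+ r)%:E)%E.

Lemma moment0 : moment 0 = 1.
Proof.
rewrite /moment; under eq_integral do rewrite expr0.
rewrite integral_cst // mul1e.
exact: (congr1 fine (probability_setT law)).
Qed.

Section IidEntries.
Context {d : measure_display} {T : measurableType d} (P : probability T R).
Variables (n : nat) (A : 'I_n -> 'I_n -> {RV P >-> R}).
Hypothesis A_iid : iid_entries law A.

Lemma entry_power_integrable i j r :
  law.-integrable setT (fun x : R => (x ^+ r)%:E) ->
  P.-integrable setT (fun w => (A i j w ^+ r)%:E) /\
  (\int[P]_w (A i j w ^+ r)%:E = (moment r)%:E)%E.
Proof.
move=> ir; have [_ AO] := A_iid.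
have mA : measurable_fun setT (A i j) by exact: measurable_funP.
have mr : measurable_fun [set: R] (fun x : R => x ^+ r).
  exact: measurable_funX.
have OE (f : R -> \bar R) : (\int[distribution P (A i j)]_x f x = \int[law]_x f x)%E.
  by apply: eq_measure_integral => B mB _; apply: AO.
have iA : P.-integrable setT (fun w => (A i j w ^+ r)%:E).
  apply/integrableP; split.
    by apply/measurable_EFinP; apply: (measurableT_comp mr mA).
  have /integrableP[_] := ir.
  rewrite -OE ge0_integral_pushforward //.
  by apply: measurableT_comp => //; exact/measurable_EFinP.
split=> //; rewrite /moment fineK ?integral_fune_fin_num // -OE.
rewrite integral_pushforward //.
by apply/measurable_EFinP.
Qed.

Variable K : nat.
Hypothesis law_moments : forall r, (r <= K)%N ->
  law.-integrable setT (fun x : R => (x ^+ r)%:E).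

(** The entry [(i, j)] occurs once for every colour that row [i] sends to [j]. *)
Lemma expectation_monomial (C : {ffun 'I_n -> {ffun 'I_K -> 'I_n}}) :
  P.-integrable setT (fun w => (\prod_i \prod_a A i (C i a) w)%:E) /\
  (\int[P]_w (\prod_i \prod_a A i (C i a) w)%:E =
    (\prod_i row_weight moment (C i))%:E)%E.
Proof.
pose N (p : 'I_n * 'I_n) := #|finset (fun a => C p.1 a == p.2)|.
have NK p : (N p <= K)%N by rewrite -[leqRHS]card_ord max_card.
have [Aind _] := A_iid.
have pE : (fun w => (\prod_i \prod_a A i (C i a) w)%:E) =
          (fun w => (\prod_p A p.1 p.2 w ^+ N p)%:E).
  apply/funext => w; congr EFin; rewrite -(pair_bigA _ (fun i j => A i j w ^+ N (i, j))) /=.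
  apply: eq_bigr => i _.
  rewrite (partition_big (C i) xpredT) //=; apply: eq_bigr => j _.
  rewrite (eq_bigr (fun=> A i j w)) => [|a /eqP ->//].
  by rewrite prodr_const /N; congr (_ ^+ _); apply: eq_card => a; rewrite !inE.
have -> : \prod_i row_weight moment (C i) = \prod_p moment (N p).
  by rewrite -(pair_bigA _ (fun i j => moment (N (i, j)))).
have [|||ip ep] := @integral_prod _ _ _ P _ _ Aind (fun p x => x ^+ N p) (fun p => moment (N p)).
- by move=> p; exact: measurable_funX.
- by move=> p; case: (entry_power_integrable p.1 p.2 (law_moments (NK p))).
- by move=> p; case: (entry_power_integrable p.1 p.2 (law_moments (NK p))).
by rewrite pE; split.
Qed.

(** The rows are independent, so the signed expansion of the power of the
determinant may be averaged row by row. *)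
Lemma det_moment_row_op : det_moment K A =
  iter n (row_op K moment n) (@word_sign R (n * K)) [::].
Proof.
rewrite /det_moment unlock.
have -> : (fun w => (\det (\matrix_(i < n, j < n) A i j w) ^+ K)%:E) =
  (fun w => \sum_(C : {ffun 'I_n -> {ffun 'I_K -> 'I_n}})
     ((@word_sign R (n * K) (rows_word C))%:E * (\prod_i \prod_a A i (C i a) w)%:E))%E.
  apply/funext => w; rewrite det_pow -sumEFin; apply: eq_bigr => C _.
  rewrite mulrC -EFinM; congr (_ * _)%:E.
  by apply: eq_bigr => i _; apply: eq_bigr => a _; rewrite mxE.
rewrite integral_sum //; last first.
  by move=> C; apply: integrableZl => //; case: (expectation_monomial C).
under eq_bigr => C _.
  have [iC eC] := expectation_monomial C.
  rewrite integralZl // eC -EFinM.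
over.
rewrite sumEFin /= iter_row_op; apply: eq_bigr => C _.
by rewrite mulrC.
Qed.

End IidEntries.
End Moments.

(** Only the diagonal term [i = n] survives in the coefficient of [t ^ (2 n)]. *)
Theorem det_moment_D_finite (R : realType) (law : probability R R) (K : nat)
    (K_gt0 : (0 < K)%N)
    (law_moments : forall r, (r <= K)%N ->
       law.-integrable setT (fun x : R => (x ^+ r)%:E))
    (d : nat -> measure_display) (T : forall n : nat, measurableType (d n))
    (P : forall n : nat, probability (T n) R)
    (A : forall n : nat, 'I_n -> 'I_n -> {RV (P n) >-> R})
    (A_iid : forall n : nat, iid_entries law (A n)) :
  D_finite (fun n : nat => det_moment K (A n) / (n`!)%:R ^+ 2).
Proof.
have [ker [kerK ker_row]] := @row_op_words R K _ (moment0 law).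
have ker0 x : x \in ker -> finset.set0 \notin x.2 by case/kerK.
have [p [q pq]] := moments_exp_coef ker0 ker_row.
apply: (pairing_exp_D_finite (p := p) (q := q)) => n.
rewrite -pq (det_moment_row_op (A_iid n) law_moments).
have nn : (n < (n + n).+1)%N by rewrite ltnS leq_addr.
rewrite (bigD1 (Ordinal nn)) //= big1 ?addr0 => [|i ni].
  by rewrite addnK mulrC -invfM -expr2.
rewrite (iter_row_size ker_row K_gt0) ?mulr0 // => [e|x /kerK[_]]; last exact.
case/eqP: ni; apply: val_inj => /=.
have := ltn_ord i; lia.
Qed.

(** Lower powers are dominated by [1 + x ^ 6]. *)
Lemma low_powers_integrable (R : realType) (law : probability R R) (r : nat) :
  law.-integrable setT (fun x : R => (x ^+ 6)%:E) -> (r <= 6)%N ->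
  law.-integrable setT (fun x : R => (x ^+ r)%:E).
Proof.
move=> i6 r6.
have i1 : law.-integrable setT (fun x : R => (1 + x ^+ 6)%:E).
  have -> : (fun x : R => (1 + x ^+ 6)%:E) = ((fun=> 1%:E) \+ (fun x : R => (x ^+ 6)%:E))%E.
    by apply/funext => x; rewrite EFinD.
  by apply: integrableD => //; apply: finite_measure_integrable_cst.
apply: le_integrable i1 => //; first by apply/measurable_EFinP; exact: measurable_funX.
move=> x _; rewrite lee_fin normrX.
have x6 : x ^+ 6 = `|x| ^+ 6 by rewrite -normrX ger0_norm // exprn_even_ge0.
have -> : `|1 + x ^+ 6| = 1 + `|x| ^+ 6.
  by rewrite x6 [LHS]ger0_norm // addr_ge0 // exprn_ge0.
have [x1|x1] := lerP `|x| 1.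
  apply: (@le_trans _ _ 1); first exact: exprn_ile1.
  by rewrite lerDl exprn_ge0.
apply: (@le_trans _ _ (`|x| ^+ 6)); last by rewrite lerDr.
by rewrite ler_weXn2l // ltW.
Qed.

Theorem mainTheorem2 (R : realType) (Omega : probability R R)
    (Omega_moment6 : Omega.-integrable setT (fun x : R => (x ^+ 6)%:E))
    (d : nat -> measure_display) (T : forall n : nat, measurableType (d n))
    (P : forall n : nat, probability (T n) R)
    (A : forall n : nat, 'I_n -> 'I_n -> {RV (P n) >-> R})
    (A_iid : forall n : nat, iid_entries Omega (A n)) :
  D_finite (fun n : nat => det_moment 6 (A n) / (n`!)%:R ^+ 2).

Proof.
apply: det_moment_D_finite A_iid => // r r6.
exact: low_powers_integrable Omega_moment6 r6.
Qed.
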